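(* A 3-dimensional $\phi$-recurrent contact metric manifold $(M,\eta,\xi,\phi,g)$ is of constant curvature $\lambda$ if and only if $\lambda=0$.
   Context: A contact metric manifold is a $(2n+1)$-dimensional manifold $M$ with a global 1-form $\eta$ satisfying $\eta\wedge(d\eta)^n\neq 0$ everywhere, the characteristic vector field $\xi$ (the unique vector field with $\eta(\xi)=1$ and $d\eta(\xi,X)=0$ for all $X$), a Riemannian metric $g$ and a $(1,1)$-tensor field $\phi$ such that for all vector fields $X,Y$: $\eta(X)=g(X,\xi)$, $d\eta(X,Y)=g(X,\phi Y)$, $\phi^2X=-X+\eta(X)\xi$. Convention: $d\eta(X,Y)=\frac12\big(X\eta(Y)-Y\eta(X)-\eta([X,Y])\big)$. Here the dimension is 3, i.e. $n=1$. Let $\nabla$ be the Levi-Civita connection of $g$ and $R(X,Y)Z=\nabla_X\nabla_YZ-\nabla_Y\nabla_XZ-\nabla_{[X,Y]}Z$ its curvature tensor. A contact metric manifold is $\phi$-recurrent if there exists a non-zero 1-form $A$ such that $\phi^2((\nabla_WR)(X,Y)Z)=A(W)R(X,Y)Z$ for all vector fields $X,Y,Z,W$ (not necessarily orthogonal to $\xi$). Constant curvature $\lambda$ (with $\lambda$ a real constant) means $R(X,Y)Z=\lambda(g(Y,Z)X-g(X,Z)Y)$ for all vector fields $X,Y,Z$.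
   Formalization: M is assumed connected and A only not identically zero; without connectedness the claim fails for the disjoint union of the unit 3-sphere (A = 0) and a flat contact metric 3-torus (A non-zero), which is φ-recurrent but not flat. *)

(* Defs.v *)
From HB Require Import structures.
From mathcomp Require Import all_boot all_order all_algebra.
From mathcomp Require Import all_classical all_reals all_analysis.

Set Implicit Arguments.
Unset Strict Implicit.
Unset Printing Implicit Defensive.

Import Order.TTheory GRing.Theory Num.Theory.
Import numFieldNormedType.Exports.

Local Open Scope classical_set_scope.
Local Open Scope ring_scope.

Section SmoothFunctionsOnOpenSets.
Context {R : realType} {n : nat}.
Implicit Types (U : set 'rV[R]_n) (f g : 'rV[R]_n -> R).

(* f is C^k on the open set U: f is continuous on U and, when k > 0, its      *)
(* first partial derivatives exist on U and are C^(k-1) there.                *)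
Fixpoint Ck (k : nat) U f : Prop :=
  {in U, continuous f} /\
  match k with
  | 0 => True
  | k'.+1 => forall i : 'I_n,
      (forall x, U x -> derivable f x (delta_mx 0 i)) /\
      Ck k' U (fun x => 'D_(delta_mx 0 i) f x)
  end.

Definition smooth_on U f : Prop := forall k, Ck k U f.

Lemma Ck_ext k U f g : open U -> (forall x, U x -> f x = g x) ->
  Ck k U f -> Ck k U g.
Proof.
move=> Uo.
have near_U x : U x -> \forall y \near x, U y.
  by move=> Ux; apply: open_nbhs_nbhs.
have ext_cont (h1 h2 : 'rV[R]_n -> R) : (forall x, U x -> h1 x = h2 x) ->
    {in U, continuous h1} -> {in U, continuous h2}.
  move=> h12 ch x xU; have Ux : U x by rewrite inE in xU.
  have near_h : \forall y \near x, h1 y = h2 y.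
    by apply: filterS (near_U x Ux) => y; exact: h12.
  rewrite /continuous_at -h12 //; apply: cvg_trans (ch x xU).
  exact: (@near_eq_cvg _ _ (nbhs x) _ h1 h2).
elim: k f g => [|k IH] f g fg [fc fk]; first by split=> //; exact: ext_cont fc.
split; first exact: ext_cont fc.
move=> i; have [df Dk] := fk i.
have near_fg x : U x -> \forall y \near x, f y = g y.
  by move=> Ux; apply: filterS (near_U x Ux) => y; exact: fg.
split=> [x Ux|]; first exact: near_eq_derivable (near_fg x Ux) (df x Ux).
by apply: IH Dk => x Ux; exact: near_eq_derive (near_fg x Ux).
Qed.

Lemma Ck_cst k U (a : R) : open U -> Ck k U (fun=> a).
Proof.
move=> Uo; elim: k a => [|k IH] a.
  by split=> // x _; exact: cst_continuous.
split=> [x _|i]; first exact: cst_continuous.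
split=> [x _|]; first exact: derivable_cst.
by apply: (Ck_ext Uo _ (IH 0)) => x _; rewrite derive_cst.
Qed.

Lemma CkW k U f : Ck k.+1 U f -> Ck k U f.
Proof.
elim: k f => [|k IH] f [fc fk]; first by split.
split=> // i; have [df Dk] := fk i; split=> //; exact: IH.
Qed.

Lemma CkD k U f g : open U -> Ck k U f -> Ck k U g ->
  Ck k U (fun x => f x + g x).
Proof.
move=> Uo; elim: k f g => [|k IH] f g [fc fk] [gc gk].
  by split=> // x xU; exact: continuousD (fc x xU) (gc x xU).
split=> [x xU|i]; first by exact: continuousD (fc x xU) (gc x xU).
have [df Df] := fk i; have [dg Dg] := gk i.
split=> [x Ux|]; first exact: derivableD (df x Ux) (dg x Ux).
apply: (Ck_ext Uo _ (IH _ _ Df Dg)) => x Ux.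
by rewrite (deriveD (df x Ux) (dg x Ux)).
Qed.

Lemma CkM k U f g : open U -> Ck k U f -> Ck k U g ->
  Ck k U (fun x => f x * g x).
Proof.
move=> Uo; elim: k f g => [|k IH] f g.
  by case=> fc _ [gc _]; split=> // x xU; exact: continuousM (fc x xU) (gc x xU).
move=> fk1 gk1; have fk := CkW fk1; have gk := CkW gk1.
case: fk1 gk1 => fc f1 [gc g1].
split=> [x xU|i]; first by exact: continuousM (fc x xU) (gc x xU).
have [df Df] := f1 i; have [dg Dg] := g1 i.
split=> [x Ux|]; first exact: derivableM (df x Ux) (dg x Ux).
apply: (Ck_ext Uo _ (CkD Uo (IH _ _ fk Dg) (IH _ _ gk Df))) => x Ux.
by rewrite (deriveM (df x Ux) (dg x Ux)).
Qed.

End SmoothFunctionsOnOpenSets.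

Section Manifolds.
Context (R : realType) (n : nat).

(* chart_inv is relevant only on the image of chart_dom. *)
Record chart (T : topologicalType) := Chart {
  chart_dom : set T;
  chart_map : T -> 'rV[R]_n;
  chart_inv : 'rV[R]_n -> T;
  chart_dom_open : open chart_dom;
  chart_img_open : open (chart_map @` chart_dom);
  chart_mapK : {in chart_dom, cancel chart_map chart_inv};
  chart_map_continuous : {within chart_dom, continuous chart_map};
  chart_inv_continuous :
    {within chart_map @` chart_dom, continuous chart_inv} }.

(* Manifolds are Hausdorff, second countable and connected, as usual in       *)
(* Riemannian geometry; the atlas need not be maximal.                        *)
Record manifold := Manifold {
  carrier :> topologicalType;
  atlas : set (chart carrier);
  manifold_hausdorff : hausdorff_space carrier;
  manifold_second_countable : @second_countable carrier;
  manifold_connected : connected [set: carrier];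
  atlas_cover : forall p, exists2 c, atlas c & chart_dom c p;
  atlas_compatible : forall c d, atlas c -> atlas d -> forall j : 'I_n,
    smooth_on (chart_map c @` (chart_dom c `&` chart_dom d))
              (fun x => chart_map d (chart_inv c x) 0 j) }.

End Manifolds.

Section SmoothFunctions.
Context (R : realType) (n : nat) (M : manifold R n).

Definition smooth (f : M -> R) : Prop := forall c, atlas c ->
  smooth_on (chart_map c @` chart_dom c) (f \o chart_inv c).

Definition smooth_pred : {pred M -> R} := mem [set f | smooth f].

Lemma smooth_subring : subring_closed smooth_pred.
Proof.
split.
- rewrite inE => c _ k; apply: Ck_cst; exact: chart_img_open.
- move=> f g; rewrite !inE => fs gs c Ac k.
  have Uo := @chart_img_open R n M c.
  have Ng := CkM Uo (Ck_cst k (-1) Uo) (gs c Ac k).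
  apply: (Ck_ext Uo _ (CkD Uo (fs c Ac k) Ng)) => x _ /=.
  by rewrite mulN1r.
- move=> f g; rewrite !inE => fs gs c Ac k.
  exact: CkM (@chart_img_open R n M c) (fs c Ac k) (gs c Ac k).
Qed.

Lemma smooth_scaler : scaler_closed smooth_pred.
Proof.
move=> a f; rewrite !inE => fs c Ac k.
have Uo := @chart_img_open R n M c.
exact: CkM Uo (Ck_cst k a Uo) (fs c Ac k).
Qed.

HB.instance Definition _ := GRing.isSubringClosed.Build (M -> R) smooth_pred
  smooth_subring.
HB.instance Definition _ := GRing.isScaleClosed.Build R (M -> R) smooth_pred
  smooth_scaler.

Record Cinf := SmoothFun { Cinf_val :> M -> R; _ : Cinf_val \in smooth_pred }.

HB.instance Definition _ := [isSub for Cinf_val].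
HB.instance Definition _ := [Choice of Cinf by <:].
HB.instance Definition _ := 
  GRing.SubChoice_isSubComPzRing.Build (M -> R) smooth_pred Cinf smooth_subring.
HB.instance Definition _ := [SubZmodule_isSubLmodule of Cinf by <:].

Lemma Cinf_scalerAr (a : R) (f h : Cinf) : f * (a *: h) = a *: (f * h).
Proof. by apply/val_inj/funext => p; rewrite /= mulrCA. Qed.

Definition constf (a : R) : Cinf := a *: (1 : Cinf).

End SmoothFunctions.

Section VectorFields.
Context (R : realType) (n : nat) (M : manifold R n).
Local Notation C := (Cinf M).

(* Vector fields are the R-linear derivations of the ring of smooth           *)
(* functions; the module structure over that ring is (f *: X) h = f * X h.    *)
Definition derivation (X : C -> C^o) : Prop :=
  (forall (a : R) (f h : C), X (a *: f + h) = a *: (X f : C) + X h) /\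
  (forall f h : C, X (f * h) = f * X h + h * X f).

Definition derivation_pred : {pred C -> C^o} := mem [set X | derivation X].

Lemma derivation_submod : submod_closed derivation_pred.
Proof.
split.
  by rewrite inE; split=> [a f h|f h]; rewrite /= ?scaler0 ?mulr0 ?addr0.
move=> c X Y; rewrite !inE => -[Xl XM] [Yl YM].
have E u : (c *: X + Y) u = c * (X u : C) + (Y u : C) by [].
split=> [a f h|f h]; rewrite !E.
  by rewrite Xl Yl mulrDr Cinf_scalerAr scalerDr addrACA.
by rewrite XM YM !mulrDr addrACA !(mulrCA c).
Qed.

HB.instance Definition _ := GRing.isSubmodClosed.Build C (C -> C^o)
  derivation_pred derivation_submod.

Record vector_field :=
  VectorField { vf_val :> C -> C^o; _ : vf_val \in derivation_pred }.

HB.instance Definition _ := [isSub for vf_val].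
HB.instance Definition _ := [Choice of vector_field by <:].
HB.instance Definition _ := [SubChoice_isSubLmodule of vector_field by <:].

Implicit Types X Y Z U V W : vector_field.

Definition bracket_fun X Y (f : C) : C^o := X (Y f) - Y (X f).

Lemma bracket_derivation X Y : bracket_fun X Y \in derivation_pred.
Proof.
rewrite inE /bracket_fun; case: X Y => [X +] [Y +] /=.
rewrite !inE => -[Xl XM] [Yl YM]; split=> [a f h|f h].
  by rewrite !(Xl, Yl) opprD addrACA scalerBr.
have XD u v : X (u + v) = X u + X v.
  by rewrite -[in LHS](scale1r u) Xl scale1r.
have YD u v : Y (u + v) = Y u + Y v.
  by rewrite -[in LHS](scale1r u) Yl scale1r.
rewrite !(XM, YM, XD, YD) !mulrBr.
rewrite (mulrC (X h)) (mulrC (X f)) addrACA [X in _ - X]addrACA.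
rewrite (addrC (Y f * X h)) opprD [LHS]addrACA subrr addr0 opprD.
by rewrite [LHS]addrACA.
Qed.

Definition bracket X Y : vector_field := VectorField (bracket_derivation X Y).

Definition vanishes_at (X : vector_field) (p : M) : Prop :=
  forall f : C, (X f : C) p = 0.

(* Tensor fields are encoded as maps on global vector fields that are linear  *)
(* over the ring of smooth functions.                                         *)
Definition one_form := {linear vector_field -> C^o}.

Definition ext_d (eta : one_form) (X Y : vector_field) : C :=
  2^-1 *: ((X (eta Y) - Y (eta X) - eta (bracket X Y)) : C).

(* Alternation (1/3!) sum_s sgn(s) s.(eta (x) d eta), d eta being             *)
(* antisymmetric; this normalization goes with the factor 1/2 in ext_d.       *)
Definition wedge_ext_d (eta : one_form) (X Y Z : vector_field) : C :=
  3^-1 *: ((eta X * ext_d eta Y Z + eta Y * ext_d eta Z X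
             + eta Z * ext_d eta X Y) : C).

Record metric := Metric {
  metric_val :> vector_field -> vector_field -> C;
  metric_linear : forall (f : C) U V W,
    metric_val (f *: U + V) W = f * metric_val U W + metric_val V W;
  metric_sym : forall U V, metric_val U V = metric_val V U;
  metric_pos : forall U p, ~ vanishes_at U p -> 0 < metric_val U U p }.

Definition levi_civita (g : metric)
    (nabla : vector_field -> vector_field -> vector_field) : Prop :=
  [/\ forall (f : C) X Y Z, nabla (f *: X + Y) Z = f *: nabla X Z + nabla Y Z,
      forall X Y Z, nabla X (Y + Z) = nabla X Y + nabla X Z,
      forall X (f : C) Y, nabla X (f *: Y) = (X f : C) *: Y + f *: nabla X Y,
      forall X Y, nabla X Y - nabla Y X = bracket X Y
    & forall X Y Z, X (g Y Z) = g (nabla X Y) Z + g Y (nabla X Z)].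

Section Curvature.
Variable nabla : vector_field -> vector_field -> vector_field.

Definition curvature X Y Z : vector_field :=
  nabla X (nabla Y Z) - nabla Y (nabla X Z) - nabla (bracket X Y) Z.

(* (nabla_W R)(X, Y) Z *)
Definition nabla_curvature W X Y Z : vector_field :=
  nabla W (curvature X Y Z) - curvature (nabla W X) Y Z
  - curvature X (nabla W Y) Z - curvature X Y (nabla W Z).

Definition constant_curvature (g : metric) (lambda : R) : Prop :=
  forall X Y Z, curvature X Y Z = constf M lambda *: (g Y Z *: X - g X Z *: Y).

End Curvature.
End VectorFields.

Section ContactMetric.
Context (R : realType) (M : manifold R 3).
Local Notation C := (Cinf M).
Local Notation VF := (vector_field M).

Record contact_metric := ContactMetric {
  cm_eta : one_form M;
  cm_xi : VF;
  cm_phi : {linear VF -> VF};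
  cm_g : metric M;
  cm_contact : forall p, exists X Y Z, wedge_ext_d cm_eta X Y Z p <> 0;
  cm_eta_xi : cm_eta cm_xi = 1;
  cm_d_eta_xi : forall X, ext_d cm_eta cm_xi X = 0;
  cm_eta_g : forall X, cm_eta X = cm_g X cm_xi;
  cm_d_eta_g : forall X Y, ext_d cm_eta X Y = cm_g X (cm_phi Y);
  cm_phi2 : forall X, cm_phi (cm_phi X) = - X + (cm_eta X : C) *: cm_xi }.

Definition phi_recurrent (S : contact_metric) (nabla : VF -> VF -> VF) : Prop :=
  exists2 A : one_form M, (exists X, A X <> 0) &
    forall X Y Z W,
      cm_phi S (cm_phi S (nabla_curvature nabla W X Y Z))
      = (A W : C) *: curvature nabla X Y Z.

End ContactMetric.

(* Main.v *)
(** If R has constant curvature lambda then nabla R = 0, so recurrence gives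
  A (x) R = 0; at a point where A does not vanish, lambda <> 0 would force
  g = eta (x) eta there, hence d eta = g(., phi .) = 0, contradicting the contact
  condition.

  Conversely a phi-recurrent contact metric 3-manifold is always flat. Pairing
  the recurrence with xi gives A(W) g(R(X,Y)Z, xi) = 0, so R(X,Y)xi = 0 where
  A <> 0; differentiating, and using the recurrence again, R(X,Y)(nabla_W xi) = 0
  there. As d eta <> 0, some nabla_W xi is a nonzero vector orthogonal to xi, and
  a skew endomorphism of a 3-dimensional space killing two independent vectors
  is zero. Hence A (x) R = 0 everywhere, the recurrence says that
  (nabla_W R)(X,Y)Z is a multiple of xi, and skewness of (nabla_W R)(X,Y) makes it
  zero. So R is parallel and vanishes at some point; M being connected, R = 0.

  Since vector fields are derivations of the ring of smooth functions, pointwise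
  arguments rest on local frames, which come from bump functions and Hadamard's
  lemma f(x) = f(q) + sum_j (x_j - q_j) g_j(x). *)

Require Import Defs.
From HB Require Import structures.
From mathcomp Require Import all_boot all_order all_algebra.
From mathcomp Require Import all_classical all_reals all_analysis.
From mathcomp Require Import ring lra.

Set Implicit Arguments.
Unset Strict Implicit.
Unset Printing Implicit Defensive.

Import Order.TTheory GRing.Theory Num.Theory.
Import numFieldNormedType.Exports.
Local Open Scope classical_set_scope.
Local Open Scope ring_scope.

(** * Differential calculus on open subsets of R^n *)

Section MeanValue.
Context {R : realType} {n : nat}.
Implicit Types (x y m : 'rV[R]_n) (f : 'rV[R]_n -> R).
Local Notation e_ j := (delta_mx 0 j : 'rV[R]_n).

Lemma is_derive_line f m (v : 'rV[R]_n) (t : R) : derivable f (m + t *: v) v ->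
  is_derive t (1 : R) (fun s : R => f (m + s *: v)) ('D_v f (m + t *: v)).
Proof.
move=> df.
have E : (fun h : R => h^-1 *: (((fun s : R => f (m + s *: v)) \o shift t) (h *: 1) - f (m + t *: v)))
   = (fun h => h^-1 *: ((f \o shift (m + t *: v)) (h *: v) - f (m + t *: v))).
  apply/funext => h /=; congr (_ *: (f _ - _)).
  by rewrite [h *: 1]mulr1 scalerDl addrCA.
by split; rewrite /derivable /derive /= E.
Qed.

(** Mean value theorem along a line, for an increment [s] of either sign; written without a
    quotient, it also covers [s = 0]. *)
Lemma line_MVT f m (v : 'rV[R]_n) (s : R) :
  (forall t : R, `|t| <= `|s| -> derivable f (m + t *: v) v) ->
  exists2 c : R, `|c| <= `|s| & f (m + s *: v) - f m = s * 'D_v f (m + c *: v).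
Proof.
move=> df.
have dl (t : R) : `|t| <= `|s| -> is_derive t (1 : R) (fun s : R => f (m + s *: v)) ('D_v f (m + t *: v)).
  by move=> ts; apply: is_derive_line; exact: df.
have cl (a b : R) : (forall t : R, t \in `[a, b]%R -> `|t| <= `|s|) ->
    {within `[a, b], continuous (fun s : R => f (m + s *: v))}.
  move=> ab; apply: derivable_within_continuous => t tab.
  by have [] := dl t (ab t tab).
have [s0|s0] := leP 0 s.
  have ab (t : R) : t \in `[0, s]%R -> `|t| <= `|s|.
    by rewrite in_itv/= => /andP[t0 ts]; rewrite !ger0_norm.
  have [|c cs] := @MVT_segment R _ (fun t => 'D_v f (m + t *: v)) _ _ s0 _ (cl _ _ ab).
    by move=> t ts; apply: dl; apply: ab; exact: subset_itv_oo_cc.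
  by rewrite scale0r addr0 subr0 mulrC => Ec; exists c => //; exact: ab.
have ab (t : R) : t \in `[s, 0]%R -> `|t| <= `|s|.
  rewrite in_itv/= => /andP[st t0]; rewrite !ler0_norm//; last exact: ltW.
  by rewrite lerN2.
have [|c cs] := @MVT_segment R _ (fun t => 'D_v f (m + t *: v)) _ _ (ltW s0) _ (cl _ _ ab).
  by move=> t ts; apply: dl; apply: ab; exact: subset_itv_oo_cc.
rewrite scale0r addr0 sub0r => Ec; exists c; first exact: ab.
by rewrite -[LHS]opprB Ec mulrN opprK mulrC.
Qed.

Definition mix x y k : 'rV[R]_n := \row_j if (j < k)%N then y 0 j else x 0 j.

Lemma mix0 x y : mix x y 0 = x.
Proof. by apply/rowP => j; rewrite mxE. Qed.

Lemma mixn x y : mix x y n = y.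
Proof. by apply/rowP => j; rewrite mxE ltn_ord. Qed.

Lemma mixS x y (j : 'I_n) : mix x y j.+1 = mix x y j + (y 0 j - x 0 j) *: e_ j.
Proof.
apply/rowP => i; rewrite !mxE eqxx/= ltnS leq_eqVlt.
have [->|ij] := eqVneq i j; first by rewrite eqxx ltnn mulr1 subrKC.
by rewrite (negPf (ij : val i != val j)) mulr0 addr0.
Qed.

(* Coordinatewise difference quotient along the broken line [mix x y]; the junk
   case [y 0 j = x 0 j] is filled with the partial derivative, which makes
   [slope] continuous at [x] for C^1 functions (Caratheodory's form of
   differentiability). *)
Definition slope f x y (j : 'I_n) : R :=
  if y 0 j == x 0 j then 'D_(e_ j) f (mix x y j)
  else (f (mix x y j.+1) - f (mix x y j)) / (y 0 j - x 0 j).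

Lemma slope_sum f x y :
  f y - f x = \sum_(j < n) (y 0 j - x 0 j) * slope f x y j.
Proof.
transitivity (\sum_(j < n) (f (mix x y j.+1) - f (mix x y j))).
  by rewrite -(big_mkord xpredT (fun j => f (mix x y j.+1) - f (mix x y j)))
       telescope_sumr // mix0 mixn.
apply: eq_bigr => j _; rewrite /slope; case: eqP => [yx|/eqP yx].
  by rewrite mixS yx subrr scale0r addr0 subrr mul0r.
by rewrite mulrCA divff ?mulr1// subr_eq0.
Qed.

Lemma ballrV x (e : R) y : 0 < e -> (forall j, `|x 0 j - y 0 j| < e) -> ball x e y.
Proof. by move=> e0 H; split=> // i j; rewrite ord1; exact: H. Qed.

Lemma slope_cvg f x (j : 'I_n) :
  (\forall y \near x, derivable f y (e_ j)) ->
  {for x, continuous (fun y => 'D_(e_ j) f y)} ->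
  slope f x y j @[y --> x] --> 'D_(e_ j) f x.
Proof.
move=> df cD; apply/(@cvgrPdist_lt _ _ _ _ (nbhs_filter x)) => eps eps0.
move/(@cvgrPdist_lt _ _ _ _ (nbhs_filter x)): cD => /(_ _ eps0) cD.
have H : nbhs x ([set y | derivable f y (e_ j)] `&`
    [set y | `|'D_(e_ j) f x - 'D_(e_ j) f y| < eps]) by apply: filterI.
have [d d0 Hd] := (nbhs_ballP _ _).1 H.
apply/nbhs_ballP; exists d => //= y [_ xy].
(* In each coordinate, a point of the [j]-th segment of the broken line is no farther from [x] than
   [y] is, so it stays in the same sup-norm ball. *)
have inb k (t : R) : `|t| <= `|y 0 j - x 0 j| -> (k = j :> nat) ->
    ball x d (mix x y k + t *: e_ j).
  move=> tj kj; apply: ballrV => // i; rewrite !mxE eqxx/= kj.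
  have [->|ij] := eqVneq i j.
    rewrite ltnn mulr1 opprD addNKr normrN.
    by apply: le_lt_trans tj _; rewrite distrC; exact: xy.
  rewrite mulr0 addr0; case: ifP => _; first exact: xy.
  by rewrite subrr normr0.
rewrite /slope; case: eqP => [yx|/eqP yx].
  have /Hd[_ H1] := inb j 0 ltac:(by rewrite normr0) erefl.
  by move: H1; rewrite scale0r addr0.
have [|c cs] := @line_MVT f (mix x y j) (e_ j) (y 0 j - x 0 j).
  by move=> t tj; have /Hd[] := inb j t tj erefl.
rewrite -mixS => ->; rewrite mulrAC divff ?mul1r ?subr_eq0//.
by have /Hd[_] := inb j c cs erefl.
Qed.

End MeanValue.

(** * The chain rule for maps into R^n *)

Section ChainRule.
Context {R : realType} {n : nat}.
Local Notation e_ j := (delta_mx 0 j).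

Lemma cvg_rV (T : Type) (F : set_system T) (FF : Filter F) (g : T -> 'rV[R]_n) (l : 'rV[R]_n) :
  (forall j, g t 0 j @[t --> F] --> l 0 j) -> g @ F --> l.
Proof.
move=> H; apply/cvg_ballP => e e0.
have : \forall t \near F, forall j : 'I_n, ball (l 0 j) e (g t 0 j).
  by apply: filter_forall => j; move/cvg_ballP: (H j) => /(_ _ e0).
by apply: filterS => t Ht; apply: ballrV.
Qed.

(** [slope_sum] writes the increment of [f] as a sum of increments of the coordinates of [T] times
    slopes, and [slope_cvg] gives the limit of each slope. *)
Lemma is_derive_comp_rV (V : normedModType R) (f : 'rV[R]_n -> R)
    (T : V -> 'rV[R]_n) (a v : V) :
  (forall j, \forall y \near T a, derivable f y (e_ j)) ->
  (forall j, {for T a, continuous (fun y => 'D_(e_ j) f y)}) ->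
  (forall j, derivable (fun x => T x 0 j) a v) ->
  is_derive a v (f \o T)
    (\sum_j 'D_v (fun x => T x 0 j) a * 'D_(e_ j) f (T a)).
Proof.
move=> df cD dT.
(* Derivability in the direction [v] gives continuity of [T] along that line only, which is enough
   for the limit in [h]. *)
have Tc : T (h *: v + a) @[h --> 0^'] --> T a.
  apply: cvg_rV => j.
  have /derivable1P/derivable1_diffP/differentiable_continuous c := dT j.
  have : T (h *: v + a) 0 j @[h --> 0^'] --> T (0 *: v + a) 0 j.
    exact: cvg_within_filter c.
  by rewrite scale0r add0r.
suff H : (fun h : R => h^-1 *: (((f \o T) \o shift a) (h *: v) - (f \o T) a)) @ 0^' -->
   \sum_j 'D_v (fun x => T x 0 j) a * 'D_(e_ j) f (T a).
  by split; [apply/cvg_ex; eexists; exact: H | exact: cvg_lim H].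
have -> : (fun h : R => h^-1 *: (((f \o T) \o shift a) (h *: v) - (f \o T) a)) =
  \sum_j (fun h => h^-1 *: (T (h *: v + a) 0 j - T a 0 j) * slope f (T a) (T (h *: v + a)) j).
  apply/funext => h; rewrite /= slope_sum scaler_sumr fct_sumE.
  by apply: eq_bigr => j _; rewrite scalerAl.
apply: (big_ind2 (fun (g : R -> R) (l : R) => g h @[h --> 0^'] --> l)) => [|g1 l1 g2 l2|j _].
- exact: cvg_cst.
- exact: cvgD.
apply: cvgM; first exact: (dT j).
by apply: (cvg_comp _ (fun y => slope f (T a) y j) Tc); exact: slope_cvg.
Qed.

End ChainRule.

(** * Calculus of C^k functions *)

Section SmoothCalculus.
Context {R : realType}.
Local Notation e_ j := (delta_mx 0 j).

Section OneDimension.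
Context {n : nat}.
Implicit Types (U V : set 'rV[R]_n) (f g : 'rV[R]_n -> R).

Lemma Ck_continuous k U f : Ck k U f -> {in U, continuous f}.
Proof. by case: k => [|k] []. Qed.

Lemma Ck_sub k U V f : U `<=` V -> Ck k V f -> Ck k U f.
Proof.
move=> UV; elim: k f => [|k IH] f [fc fk].
  by split=> // x xU; apply: fc; rewrite inE; apply: UV; rewrite -inE.
split=> [x xU|i]; first by apply: fc; rewrite inE; apply: UV; rewrite -inE.
by have [df Dk] := fk i; split=> [x /UV/df//|]; exact: IH.
Qed.

Lemma CkU k U V f : Ck k U f -> Ck k V f -> Ck k (U `|` V) f.
Proof.
have cU g : {in U, continuous g} -> {in V, continuous g} ->
    {in U `|` V, continuous g}.
  by move=> gU gV x; rewrite inE => -[xU|xV]; [apply: gU|apply: gV]; rewrite inE.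
elim: k f => [|k IH] f [fc fk] [gc gk]; split=> //; try exact: cU.
move=> i; have [df Df] := fk i; have [dg Dg] := gk i.
by split=> [x [/df//|/dg//]|]; exact: IH.
Qed.

Lemma Ck_sum k U (I : finType) (F : I -> 'rV[R]_n -> R) : open U ->
  (forall i, Ck k U (F i)) -> Ck k U (fun x => \sum_i F i x).
Proof.
move=> Uo FU.
have -> : (fun x => \sum_i F i x) = \sum_i F i.
  by apply/funext => x; rewrite fct_sumE.
apply: (big_ind (Ck k U)) => [|f g fU gU|i _]; last exact: FU.
  exact: Ck_cst.
exact: CkD.
Qed.

Lemma open_near U x : open U -> U x -> \forall y \near x, U y.
Proof. by move=> Uo Ux; apply: open_nbhs_nbhs. Qed.

Lemma Ck1_near U f x (j : 'I_n) : open U -> Ck 1 U f -> U x ->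
  (\forall y \near x, derivable f y (e_ j)) /\
  {for x, continuous (fun y => 'D_(e_ j) f y)}.
Proof.
move=> Uo [_ /(_ j)[df [cD _]]] Ux; split.
  by apply: filterS (open_near Uo Ux) => y; exact: df.
by apply: cD; rewrite inE.
Qed.

Lemma CkS_Ck1 k U f : Ck k.+1 U f -> Ck 1 U f.
Proof.
case=> fc fk; split=> // i; have [df Dk] := fk i; split=> //.
by split=> //; exact: Ck_continuous Dk.
Qed.

Lemma is_derive_coord (x v : 'rV[R]_n) (j : 'I_n) :
  is_derive x v (fun y : 'rV[R]_n => y 0 j) (v 0 j).
Proof.
have E : \forall h \near 0^', h^-1 *: (((fun y : 'rV[R]_n => y 0 j) \o shift x) (h *: v) - x 0 j) = v 0 j.
  near=> h; rewrite /= !mxE addrK [_ *: _]mulrA mulVf ?mul1r//.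
  by near: h; exact: nbhs_dnbhs_neq.
have H : (fun h => h^-1 *: (((fun y : 'rV[R]_n => y 0 j) \o shift x) (h *: v) - x 0 j)) @ 0^' --> v 0 j.
  exact: cvg_near_cst E.
split; first by apply/cvg_ex; eexists; exact: H.
exact: cvg_lim H.
Unshelve. all: end_near. Qed.

Lemma Ck_coord k U (j : 'I_n) : open U -> Ck k U (fun x => x 0 j).
Proof.
move=> Uo; have cc x : {for x, continuous (fun y : 'rV[R]_n => y 0 j)}.
  exact: coord_continuous.
have d x v := is_derive_coord x v j.
case: k => [|k].
  by split=> // x _; exact: cc.
split=> [x _|i]; first exact: cc.
split=> [x _|]; first by have [] := d x (e_ i).
apply: (Ck_ext Uo _ (Ck_cst k ((e_ i : 'rV[R]_n) 0 j) Uo)) => x _.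
by have [_ ->] := d x (e_ i).
Qed.

End OneDimension.

(** Induction on [k]: a partial derivative of [f \o T] is a sum of products of derivatives of [T]
    with partial derivatives of [f] composed with [T], and the induction hypothesis applies to the
    latter. *)
Lemma Ck_comp k n m (U : set 'rV[R]_n) (V : set 'rV[R]_m) (f : 'rV[R]_m -> R)
    (T : 'rV[R]_n -> 'rV[R]_m) : open U -> open V ->
  (forall x, U x -> V (T x)) -> (forall j, Ck k U (fun x => T x 0 j)) ->
  Ck k V f -> Ck k U (f \o T).
Proof.
move=> Uo Vo UV; elim: k f => [|k IH] f TU fV.
  split=> // x xU; apply: continuous_comp.
    apply: (@cvg_rV _ _ _ _ (nbhs_filter x)) => j.
    exact: (Ck_continuous (TU j) xU).
  by apply: (Ck_continuous fV); rewrite inE in xU; rewrite inE; exact: UV.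
have dc x i : U x -> is_derive x (e_ i) (f \o T)
    (\sum_j 'D_(e_ i) (fun x => T x 0 j) x * 'D_(e_ j) f (T x)).
  move=> Ux; apply: is_derive_comp_rV => j.
  - by have [] := Ck1_near j Vo (CkS_Ck1 fV) (UV _ Ux).
  - by have [] := Ck1_near j Vo (CkS_Ck1 fV) (UV _ Ux).
  - by have [_ /(_ i)[dT _]] := TU j; exact: dT.
split=> [|i].
  by apply: (@Ck_continuous _ k); apply: IH (CkW fV) => j; exact: CkW.
split=> [x Ux|]; first by have [] := dc x i Ux.
have H : Ck k U (fun x => \sum_j 'D_(e_ i) (fun x => T x 0 j) x * 'D_(e_ j) f (T x)).
  apply: Ck_sum => // j; apply: CkM => //; first by have [_ /(_ i)[]] := TU j.
  apply: (IH (fun y => 'D_(e_ j) f y)) => [l|]; first exact: CkW.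
  by have [_ /(_ j)[]] := fV.
by apply: (Ck_ext Uo _ H) => x Ux; have [_ ->] := dc x i Ux.
Qed.

End SmoothCalculus.

(** * Bump functions *)

Section Bump.
Context {R : realType}.
Local Notation e_ j := (delta_mx 0 j).

(* The family of all [flat p] is closed under differentiation, and [flat 1] is
   the usual exp(-1/x). *)
Definition flat (p : {poly R}) (x : R) : R :=
  if x <= 0 then 0 else p.[x^-1] * expR (- x^-1).

Lemma flat_gt0 x : 0 < x -> 0 < flat 1 x.
Proof. by move=> x0; rewrite /flat leNgt x0/= hornerC mul1r expR_gt0. Qed.

(** Each monomial is bounded by a factorial times the exponential, being up to that factor a term of
    its power series. *)
Lemma poly_le_expR (p : {poly R}) :
  exists2 C : R, 0 <= C & forall y, 0 <= y -> `|p.[y]| <= C * expR y.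
Proof.
exists (\sum_(i < size p) `|p`_i| * i`!%:R).
  by apply: sumr_ge0 => i _; rewrite mulr_ge0.
move=> y y0; rewrite horner_coef mulr_suml.
apply: le_trans (ler_norm_sum _ _ _) _; apply: ler_sum => i _.
rewrite normrM -mulrA ler_wpM2l// ger0_norm ?exprn_ge0//.
case: (val i) => [|k]; first by rewrite mul1r expr0 -expR0 ler_expR.
have := expR_ge1Dxn k y0; rewrite -ler_pdivrMl ?ltr0n ?fact_gt0//.
by apply: le_trans; rewrite mulrC lerDr.
Qed.

(** This is the previous bound for [p * 'X^2] at [x^-1]. An estimate of order two makes the
    difference quotient of [flat p] at 0 tend to 0. *)
Lemma flat_le_sqr p : exists2 C : R, 0 <= C & forall x, `|flat p x| <= C * x ^+ 2.
Proof.
have [C C0 HC] := poly_le_expR (p * 'X^2); exists C => // x.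
rewrite /flat; case: (leP x 0) => x0; first by rewrite normr0 mulr_ge0// sqr_ge0.
have y0 : 0 <= x^-1 by rewrite invr_ge0 ltW.
move: (HC _ y0); rewrite hornerM hornerXn !normrM.
rewrite (ger0_norm y0) (ger0_norm (expR_ge0 _)) expRN -expr2 exprVn => H.
by rewrite ler_pdivrMr ?expR_gt0// mulrAC -ler_pdivrMr// exprn_gt0.
Qed.

(** The polynomial is read off from differentiating [p.[x^-1] * expR (- x^-1)] for [0 < x]; at
    [x = 0] the derivative has to be 0, and the quadratic bound gives it. *)
Lemma is_derive_flat p x : is_derive x (1 : R) (flat p) (flat ('X^2 * (p - p^`())) x).
Proof.
have [x0|x0|->] := ltrgtP x 0.
- have E : \forall y \near x, 0 = flat p y.
    by near=> y; rewrite /flat ifT//; near: y; exact: lt_le_nbhsl.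
  rewrite [flat _ x]/flat ltW//; apply: (near_eq_is_derive (f := fun=> 0) E).
- have E : \forall y \near x, (p.[y^-1] * expR (- y^-1)) = flat p y.
    by near=> y; rewrite /flat leNgt ifN// negbK; near: y; exact: lt_nbhsr.
  apply: (near_eq_is_derive (f := fun y : R => p.[y^-1] * expR (- y^-1)) E).
  have xn0 : x != 0 by rewrite gt_eqF.
  have dV : is_derive x (1 : R) (fun y : R => y^-1) (- x ^- 2).
    have := @is_deriveV R (id : R -> R) x 1 1 xn0 (is_derive_id _ _).
    by rewrite /= [_ *: 1]mulr1.
  have d1 := is_derive1_comp (is_derive_poly p x^-1) dV.
  have d2 := @is_derive1_comp R expR (fun y : R => - y^-1) x _ _ (is_derive_expR _) (is_deriveN dV).
  apply: is_derive_eq (is_deriveM d1 d2) _.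
  rewrite /flat leNgt x0/= !hornerE /= /GRing.scale/= -exprVn opprK.
  by ring.
have [C C0 HC] := flat_le_sqr p.
have E : forall h : R, h^-1 *: ((flat p \o shift 0) (h *: 1) - flat p 0) = flat p h / h.
  by move=> h; rewrite /= addr0 [h *: 1]mulr1 {2}/flat lexx subr0 mulrC.
have H : (fun h => h^-1 *: ((flat p \o shift 0) (h *: (1:R)) - flat p 0)) @ 0^' --> flat ('X^2 * (p - p^`())) 0.
  rewrite {3}/flat lexx; under eq_fun do rewrite E.
  apply/cvgr0Pnorm_le => e e0; near=> h.
  have h0 : h != 0 by near: h; exact: nbhs_dnbhs_neq.
  rewrite normrM normfV ler_pdivrMr ?normr_gt0//.
  apply: le_trans (HC h) _; rewrite -[h ^+ 2]real_normK ?num_real// expr2 mulrA ler_wpM2r//.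
  have hC : `|h| < e / (C + 1).
    by near: h; apply: dnbhs0_lt; rewrite divr_gt0// ltr_wpDl.
  move: hC; rewrite ltr_pdivlMr ?ltr_wpDl// => /ltW; apply: le_trans.
  by rewrite mulrC ler_wpM2l// lerDl.
by split; [exact: cvgP H|exact: cvg_lim H].
Unshelve. all: end_near. Qed.

(** Stated on row vectors of length one, so that [Ck_comp] can compose it with functions of several
    variables. *)
Lemma Ck_flat1 k p : Ck k setT (fun y : 'rV[R]_1 => flat p (y 0 0)).
Proof.
have d q (x : 'rV[R]_1) (i : 'I_1) : is_derive x (e_ i) (fun y : 'rV[R]_1 => flat q (y 0 0))
    (flat ('X^2 * (q - q^`())) (x 0 0)).
  have [dq Dq] := is_derive_flat q (x 0 0).
  have E : (fun h : R => h^-1 *: (((fun y : 'rV[R]_1 => flat q (y 0 0)) \o shift x) (h *: (e_ i : 'rV[R]_1)) - flat q (x 0 0)))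
    = (fun h => h^-1 *: ((flat q \o shift (x 0 0)) (h *: (1 : R)) - flat q (x 0 0))).
    by apply/funext => h; rewrite /= !mxE (ord1 i) eqxx.
  by split; rewrite /derivable /derive/= E.
have c q : {in setT, continuous (fun y : 'rV[R]_1 => flat q (y 0 0))}.
  move=> x _; apply: continuous_comp; first exact: coord_continuous.
  apply/differentiable_continuous/derivable1_diffP.
  by have [] := is_derive_flat q (x 0 0).
elim: k p => [|k IH] p; split=> // i.
split=> [x _|]; first by have [] := d p x i.
apply: (Ck_ext openT _ (IH ('X^2 * (p - p^`())))) => x _.
by have [_ ->] := d p x i.
Qed.

Lemma Ck_flat n k (U : set 'rV[R]_n) (g : 'rV[R]_n -> R) p : open U -> Ck k U g ->
  Ck k U (fun x => flat p (g x)).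
Proof.
move=> Uo gU; pose T x : 'rV[R]_1 := \row_j g x.
have TU j : Ck k U (fun x => T x 0 j).
  by apply: Ck_ext gU => // x _; rewrite mxE.
have := Ck_comp Uo openT (fun _ _ => I) TU (Ck_flat1 k p).
by apply: Ck_ext => // x _ /=; rewrite mxE.
Qed.

Lemma bump_exists n (q : 'rV[R]_n) (r : R) : 0 < r ->
  exists b : 'rV[R]_n -> R, [/\ smooth_on setT b, 0 < b q &
    forall x, b x != 0 -> forall j, `|q 0 j - x 0 j| <= r].
Proof.
(* [s] is positive exactly on the open Euclidean ball of radius [r], which lies in the box required
   of the support. *)
move=> r0; pose s (x : 'rV[R]_n) := r ^+ 2 - \sum_j (x 0 j - q 0 j) ^+ 2.
exists (fun x => flat 1 (s x)); split.
- move=> k; apply: Ck_flat; first exact: openT.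
  have cj j : Ck k setT (fun x : 'rV[R]_n => x 0 j - q 0 j).
    apply: CkD; [exact: openT|apply: Ck_coord; exact: openT|].
    by apply: Ck_cst; exact: openT.
  have sj : Ck k setT (fun x : 'rV[R]_n => \sum_j (x 0 j - q 0 j) * (x 0 j - q 0 j)).
    by apply: Ck_sum; [exact: openT|move=> j; apply: CkM => //; exact: openT].
  have := CkD openT (Ck_cst k (r ^+ 2) openT) (CkM openT (Ck_cst k (-1) openT) sj).
  by apply: Ck_ext; [exact: openT|move=> x _; rewrite mulN1r].
- by apply: flat_gt0; rewrite /s big1 ?subr0 ?exprn_gt0// => j _; rewrite subrr expr0n.
move=> x; rewrite /flat; case: leP; rewrite ?eqxx// => s0 _ j.
rewrite -ler_sqr ?nnegrE//; last exact: ltW.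
rewrite distrC real_normK ?num_real//; move: s0; rewrite subr_gt0 => /ltW.
apply: le_trans; rewrite (bigD1 j)//= lerDl.
by apply: sumr_ge0 => i _; exact: sqr_ge0.
Qed.

End Bump.

(** * Hadamard's lemma *)

Section UnitIntegral.
Context {R : realType}.
Local Notation mu := (@lebesgue_measure R).
Implicit Types f g : R -> R.

Definition cont01 f := forall t : R, 0 <= t <= 1 -> {for t, continuous f}.
Definition int01 f : R := \int[mu]_(t in `[0, 1]) f t.

Lemma cont01_within f : cont01 f -> {within `[0, 1], continuous f}.
Proof.
move=> cf; apply/continuous_in_subspaceT => t; rewrite inE/= in_itv/= => t01.
exact: cf.
Qed.

Lemma cont01_integrable f : cont01 f -> mu.-integrable `[0, 1] (EFin \o f).
Proof.
move=> cf; apply: continuous_compact_integrable; first exact: segment_compact.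
exact: cont01_within.
Qed.

Lemma int01_cst (a : R) : int01 (fun=> a) = a.
Proof.
rewrite /int01 Rintegral_cst//.
have E : (mu `[0%R, 1%R]%classic = 1)%E.
  by have := @lebesgue_measure_itv R `[0%R, 1%R]; rewrite /= lte_fin ltr01 -EFinB subr0.
by rewrite [X in fine X](_ : _ = 1%E) ?mulr1.
Qed.

Lemma int01D f g : cont01 f -> cont01 g -> int01 (fun t => f t + g t) = int01 f + int01 g.
Proof. by move=> cf cg; rewrite /int01 RintegralD//; exact: cont01_integrable. Qed.

Lemma int01Z (a : R) f : cont01 f -> int01 (fun t => a * f t) = a * int01 f.
Proof. by move=> cf; rewrite /int01 RintegralZl//; exact: cont01_integrable. Qed.

Lemma cont01D f g : cont01 f -> cont01 g -> cont01 (fun t => f t + g t).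
Proof. by move=> cf cg t t01; apply: cvgD; [exact: cf|exact: cg]. Qed.

Lemma cont01Z (a : R) f : cont01 f -> cont01 (fun t => a * f t).
Proof. by move=> cf t t01; apply: cvgM; [exact: cvg_cst|exact: cf]. Qed.

Lemma cont01_cst (a : R) : cont01 (fun=> a).
Proof. by move=> t t01; exact: cvg_cst. Qed.

Lemma cont01_sum (I : Type) (s : seq I) (a : I -> R) (F : I -> R -> R) :
  (forall i, cont01 (F i)) -> cont01 (fun t => \sum_(i <- s) a i * F i t).
Proof.
move=> cF; elim: s => [|i s IH].
  by under eq_fun do rewrite big_nil; exact: cont01_cst.
under eq_fun do rewrite big_cons; apply: cont01D => //; exact: cont01Z.
Qed.

Lemma int01_sum (I : Type) (s : seq I) (a : I -> R) (F : I -> R -> R) :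
  (forall i, cont01 (F i)) ->
  int01 (fun t => \sum_(i <- s) a i * F i t) = \sum_(i <- s) a i * int01 (F i).
Proof.
move=> cF; elim: s => [|i s IH].
  by under eq_fun do rewrite big_nil; rewrite int01_cst big_nil.
under eq_fun do rewrite big_cons; rewrite big_cons int01D ?int01Z ?IH//.
  exact: cont01Z.
exact: cont01_sum.
Qed.

Lemma int01_dist f g (e : R) : cont01 f -> cont01 g ->
  (forall t, 0 <= t <= 1 -> `|f t - g t| <= e) -> `|int01 f - int01 g| <= e.
Proof.
move=> cf cg H.
have cB : cont01 (fun t => f t - g t).
  by move=> t t01; apply: cvgB; [exact: cf|exact: cg].
have -> : int01 f - int01 g = int01 (fun t => f t - g t).
  by rewrite /int01 RintegralB//; exact: cont01_integrable.
have cN : cont01 (fun t => `|f t - g t|).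
  by move=> t t01; apply: cvg_norm; exact: cB.
rewrite -[leRHS]int01_cst; apply: le_trans (le_normr_Rintegral _ _) _ => //.
  exact: cont01_integrable.
apply: le_Rintegral => //; first exact: cont01_integrable.
by apply: cont01_integrable; exact: cont01_cst.
Qed.

Lemma int01_FTC (F f : R -> R) : (forall t : R, 0 <= t <= 1 -> is_derive t 1 F (f t)) ->
  cont01 f -> int01 f = F 1 - F 0.
Proof.
move=> dF cf.
have cF : cont01 F.
  by move=> t /dF[d _]; exact/differentiable_continuous/derivable1_diffP.
rewrite /int01 /Rintegral (continuous_FTC2 ltr01 (cont01_within cf) (F := F))//.
- split=> [t|//|//].
  + by rewrite in_itv/= => /andP[t0 t1]; have [] := dF t ltac:(by rewrite !ltW).
  + by apply: cvg_at_right_filter; apply: cF; rewrite lexx ler01.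
  + by apply: cvg_at_left_filter; apply: cF; rewrite lexx ler01.
- move=> t; rewrite in_itv/= => /andP[t0 t1]; rewrite derive1E.
  by have [_] := dF t ltac:(by rewrite !ltW).
Qed.

(** A tube argument: joint continuity along the compact segment over [x] gives closeness uniform in
    [t]. *)
Lemma unif01 (X : topologicalType) (F : X -> R -> R) (x : X) :
  (forall t : R, 0 <= t <= 1 -> F z.1 z.2 @[z --> (x, t)] --> F x t) ->
  forall e, 0 < e -> \forall y \near x, forall t, 0 <= t <= 1 -> `|F x t - F y t| <= e.
Proof.
move=> cF e e0.
have cov : near_covering `[(0:R), 1]%classic.
  by apply/compact_near_coveringP; exact: segment_compact.
have H (t : R) : `[0, 1]%classic t ->
    \forall s \near t & y \near nbhs x, `|F x s - F y s| <= e.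
  rewrite /= in_itv/= => t01.
  (* Both [F x s] and [F y s] are compared with [F x t], each within [e / 2]. *)
  have e2 : 0 < e / 2 by rewrite divr_gt0.
  have [[U V] /= [Ux Vt] UV] := (cvgrPdist_lt _ _).1 (cF t t01) _ e2.
  exists (V, U) => //= -[s y] /= [Vs Uy].
  have h1 : `|F x t - F y s| < e / 2 := UV (y, s) (conj Uy Vs).
  have h2 : `|F x t - F x s| < e / 2 := UV (x, s) (conj (nbhs_singleton Ux) Vs).
  rewrite -(subrKA (F x t)) [e]splitr; apply: le_trans (ler_normD _ _) _.
  by rewrite lerD// ltW// distrC.
apply: filterS (cov _ _ _ (nbhs_filter x) H) => y Hy t t01.
by apply: Hy; rewrite /= in_itv/=.
Qed.

End UnitIntegral.

(** * Integrals along rays and Hadamard's expansion *)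

Section Hadamard.
Context {R : realType} {n : nat}.
Variables (q : 'rV[R]_n) (r : R).
Local Notation e_ j := (delta_mx 0 j : 'rV[R]_n).
Local Notation B := (ball q r).
Implicit Types (w : 'rV[R]_n -> R).

Let Bo : open B. Proof. exact: ball_open. Qed.

Lemma ray_in_ball (x : 'rV[R]_n) (t : R) : 0 <= t <= 1 -> B x -> B (q + t *: (x - q)).
Proof.
move=> /andP[t0 t1]; rewrite -ball_normE /= => qx.
rewrite opprD addNKr normrN normrZ (ger0_norm t0) distrC.
by apply: le_lt_trans qx; rewrite ler_piMl.
Qed.

(* The weight t^k makes this family closed under partial derivatives, so that
   smoothness follows by induction on the order. *)
Definition ray_int w k (x : 'rV[R]_n) : R := int01 (fun t => t ^+ k * w (q + t *: (x - q))).

Lemma ray_cvg w k (x : 'rV[R]_n) (t : R) : smooth_on B w -> B x -> 0 <= t <= 1 ->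
  z.2 ^+ k * w (q + z.2 *: (z.1 - q)) @[z --> (x, t)] --> t ^+ k * w (q + t *: (x - q)).
Proof.
move=> ws Bx t01.
have c2 : z.2 @[z --> (x, t)] --> t by exact: cvg_snd.
have c1 : z.1 @[z --> (x, t)] --> x by exact: cvg_fst.
apply: cvgM; first by apply: (cvg_comp _ (fun s => s ^+ k) c2); exact: exprn_continuous.
have cw : {for q + t *: (x - q), continuous w}.
  by apply: (Ck_continuous (ws 0)); rewrite inE; exact: ray_in_ball.
apply: (cvg_comp (fun z : 'rV[R]_n * R => q + z.2 *: (z.1 - q)) w _ cw).
apply: cvgD; first exact: cvg_cst.
by apply: cvgZ => //; apply: cvgB => //; exact: cvg_cst.
Qed.

Lemma ray_cont01 w k (x : 'rV[R]_n) : smooth_on B w -> B x -> cont01 (fun t => t ^+ k * w (q + t *: (x - q))).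
Proof.
move=> ws Bx t t01.
have c : (x, s) @[s --> t] --> (x, t).
  exact: (cvg_pair (f := fun=> x) (g := id) (cvg_cst x) (@cvg_id _ (nbhs t))).
exact: (cvg_comp (fun s : R => (x, s)) _ c (ray_cvg (k := k) ws Bx t01)).
Qed.

Lemma is_derive_ray w (x : 'rV[R]_n) (t : R) j : smooth_on B w -> B x -> 0 <= t <= 1 ->
  is_derive x (e_ j) (fun y => w (q + t *: (y - q))) (t * 'D_(e_ j) w (q + t *: (x - q))).
Proof.
move=> ws Bx t01.
pose T (y : 'rV[R]_n) := q + t *: (y - q).
have dT i : is_derive x (e_ j) (fun y => T y 0 i) (t * (e_ j) 0 i).
  have E : (fun y => T y 0 i) = (fun y => (q 0 i - t * q 0 i) + t * y 0 i).
    by apply/funext => y; rewrite /T !mxE; ring.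
  have H : (fun h : R => h^-1 *: (((fun y => T y 0 i) \o shift x) (h *: e_ j) - T x 0 i)) @ 0^' --> t * (e_ j) 0 i.
    apply: cvg_near_cst; near=> h.
    have h0 : h != 0 by near: h; exact: nbhs_dnbhs_neq.
    rewrite /= /T !mxE /GRing.scale/=.
    by field.
  by split; [exact: cvgP H|exact: cvg_lim H].
have BT : B (T x) by exact: ray_in_ball.
have H := @is_derive_comp_rV R n _ w T x (e_ j)
  (fun i => (Ck1_near i Bo (ws 1) BT).1) (fun i => (Ck1_near i Bo (ws 1) BT).2)
  (fun i => @ex_derive _ _ _ _ _ _ _ (dT i)).
apply: is_derive_eq H _.
rewrite (bigD1 j)//= big1 ?addr0 => [|i ij].
  by have [_ ->] := dT j; rewrite mxE !eqxx mulr1.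
by have [_ ->] := dT i; rewrite mxE (negPf ij) andbF mulr0 mul0r.
Unshelve. all: end_near. Qed.

Lemma is_derive_along_ray w (x : 'rV[R]_n) (t : R) : smooth_on B w -> B x -> 0 <= t <= 1 ->
  is_derive t (1 : R) (fun s : R => w (q + s *: (x - q)))
    (\sum_j (x 0 j - q 0 j) * 'D_(e_ j) w (q + t *: (x - q))).
Proof.
move=> ws Bx t01; pose T (s : R) := q + s *: (x - q).
have BT : B (T t) by exact: ray_in_ball.
have dT i : is_derive t (1 : R) (fun s => T s 0 i) (x 0 i - q 0 i).
  have H : (fun h : R => h^-1 *: (((fun s => T s 0 i) \o shift t) (h *: (1 : R)) - T t 0 i)) @ 0^' --> x 0 i - q 0 i.
    apply: cvg_near_cst; near=> h.
    have h0 : h != 0 by near: h; exact: nbhs_dnbhs_neq.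
    rewrite /= /T !mxE /GRing.scale/=.
    by field.
  by split; [exact: cvgP H|exact: cvg_lim H].
have H := @is_derive_comp_rV R n _ w T t 1
  (fun i => (Ck1_near i Bo (ws 1) BT).1) (fun i => (Ck1_near i Bo (ws 1) BT).2)
  (fun i => @ex_derive _ _ _ _ _ _ _ (dT i)).
apply: is_derive_eq H _; apply: eq_bigr => i _.
by have [_ ->] := dT i.
Unshelve. all: end_near. Qed.

Lemma ray_int_smooth w k : smooth_on B w -> smooth_on B (ray_int w k).
Proof.
move=> ws i; elim: i w k ws => [|i IH] w k ws.
  split=> // x; rewrite inE => Bx.
  apply/(@cvgrPdist_le _ _ _ _ (nbhs_filter x)) => e e0.
  have U := @unif01 R _ (fun (y : 'rV[R]_n) (t : R) => t ^+ k * w (q + t *: (y - q))) x (fun t t01 => ray_cvg (k := k) ws Bx t01) e e0.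
  have Bnear := open_near Bo Bx.
  apply: filterS2 U Bnear => y Uy By.
  by apply: int01_dist => //; exact: ray_cont01.
have Dws j : smooth_on B (fun y => 'D_(e_ j) w y).
  by move=> l; have [_ /(_ j)[]] := ws l.+1.
(* Differentiation under the integral sign: for each [t] the difference quotient of the integrand
   is, by the mean value theorem, its derivative at some [x + c *: e_ j], and [unif01] makes the
   error uniform in [t]. *)
have D j x : B x -> is_derive x (e_ j) (ray_int w k) (ray_int (fun y => 'D_(e_ j) w y) k.+1 x).
  move=> Bx.
  suff H : (fun h : R => h^-1 *: ((ray_int w k \o shift x) (h *: e_ j) - ray_int w k x)) @ 0^' --> ray_int (fun y => 'D_(e_ j) w y) k.+1 x.
    by split; [exact: cvgP H|exact: cvg_lim H].
  apply/cvgrPdist_le => e e0.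
  have U := @unif01 R _ (fun (y : 'rV[R]_n) (t : R) => t ^+ k.+1 * 'D_(e_ j) w (q + t *: (y - q))) x (fun t t01 => ray_cvg (k := k.+1) (Dws j) Bx t01) e e0.
  have Bnear := open_near Bo Bx.
  have [d d0 Hd] := (nbhs_ballP _ _).1 (filterI U Bnear).
  near=> h.
  have h0 : h != 0 by near: h; exact: nbhs_dnbhs_neq.
  have hd : `|h| < d by near: h; exact: dnbhs0_lt.
  have inb (c : R) : `|c| <= `|h| -> ball x d (x + c *: e_ j).
    move=> ch; apply: ballrV => // l; rewrite !mxE opprD addNKr normrN eqxx/=.
    have [_|_] := eqVneq l j; first by rewrite mulr1; exact: le_lt_trans hd.
    by rewrite mulr0 normr0.
  have Bc (c : R) : `|c| <= `|h| -> B (x + c *: e_ j) by move=> /inb/Hd[].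
  rewrite /= [h *: e_ j + x]addrC.
  have -> : h^-1 *: (ray_int w k (x + h *: e_ j) - ray_int w k x) =
    int01 (fun t => h^-1 * (t ^+ k * w (q + t *: ((x + h *: e_ j) - q)) +
                      (-1) * (t ^+ k * w (q + t *: (x - q))))).
    have c1 := ray_cont01 (k := k) ws (Bc h (lexx _)).
    have c2 := ray_cont01 (k := k) ws Bx.
    by rewrite int01Z ?int01D ?int01Z ?mulN1r//; [exact: cont01Z|apply: cont01D => //; exact: cont01Z].
  have c1 := ray_cont01 (k := k) ws (Bc h (lexx _)).
  have c2 := ray_cont01 (k := k) ws Bx.
  rewrite /ray_int; apply: int01_dist => [||t t01]; first exact: (ray_cont01 (k := k.+1) (Dws j) Bx).
    by apply: cont01Z; apply: cont01D => //; exact: cont01Z.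
  pose kt y := t ^+ k * w (q + t *: (y - q)).
  have dk (c : R) : `|c| <= `|h| ->
     is_derive (x + c *: e_ j) (e_ j) kt (t ^+ k.+1 * 'D_(e_ j) w (q + t *: (x + c *: e_ j - q))).
    move=> ch; have := is_deriveZ (t ^+ k) (is_derive_ray j ws (Bc c ch) t01).
    by move=> H; apply: is_derive_eq H _; rewrite exprSr -mulrA.
  have [c ch Ec] := @line_MVT R n kt x (e_ j) h (fun c ch => @ex_derive _ _ _ _ _ _ _ (dk c ch)).
  rewrite mulN1r -/(kt (x + h *: e_ j)) -/(kt x) Ec mulrA mulVf// mul1r.
  have [_ ->] := dk c ch.
  have [Uc _] := Hd _ (inb c ch).
  exact: Uc.
split=> [|j]; first by apply: (@Ck_continuous _ _ i); exact: IH.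
split=> [x Bx|]; first by have [] := D j x Bx.
apply: (Ck_ext Bo _ (IH _ k.+1 (Dws j))) => x Bx.
by have [_ ->] := D j x Bx.
Unshelve. all: end_near. Qed.

(** The fundamental theorem of calculus on the ray from [q] to [x]; [g j] at [x] is the average over
    that ray of the [j]-th partial derivative. *)
Theorem hadamard w : smooth_on B w -> exists g : 'I_n -> 'rV[R]_n -> R,
  [/\ forall j, smooth_on B (g j), forall j, g j q = 'D_(e_ j) w q &
    forall x, B x -> w x = w q + \sum_j (x 0 j - q 0 j) * g j x].
Proof.
move=> ws.
have Dws j : smooth_on B (fun y => 'D_(e_ j) w y).
  by move=> l; have [_ /(_ j)[]] := ws l.+1.
exists (fun j => ray_int (fun y => 'D_(e_ j) w y) 0); split => [j|j|x Bx].
- exact: ray_int_smooth.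
- rewrite /ray_int; under eq_fun do rewrite expr0 mul1r subrr scaler0 addr0.
  by rewrite int01_cst.
have cD j : cont01 (fun t : R => t ^+ 0 * 'D_(e_ j) w (q + t *: (x - q))).
  exact: (ray_cont01 (k := 0) (Dws j) Bx).
rewrite -(int01_sum _ (fun j => x 0 j - q 0 j) cD).
pose f (t : R) := \sum_j (x 0 j - q 0 j) * (t ^+ 0 * 'D_(e_ j) w (q + t *: (x - q))).
pose F (t : R) := w (q + t *: (x - q)).
have dF (t : R) : 0 <= t <= 1 -> is_derive t (1 : R) F (f t).
  move=> t01; apply: is_derive_eq (is_derive_along_ray ws Bx t01) _.
  by apply: eq_bigr => i _; rewrite expr0 mul1r.
rewrite (int01_FTC dF) /F; last exact: cont01_sum.
by rewrite scale1r scale0r addr0 !subrKC.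
Qed.

End Hadamard.

(** * Functions and derivations in charts *)

Section Charts.
Context {R : realType} {n : nat} {M : manifold R n}.
Local Notation C := (Cinf M).
Local Notation VF := (vector_field M).
Local Notation e_ j := (delta_mx 0 j : 'rV[R]_n).
Local Notation img c := (chart_map c @` chart_dom c).
Implicit Types (c d : chart R n M) (p : M).

Lemma chart_map_cont c p : chart_dom c p -> {for p, continuous (chart_map c)}.
Proof.
move=> cp; have : {within chart_dom c, continuous (chart_map c)} by exact: chart_map_continuous.
rewrite continuous_open_subspace; last exact: chart_dom_open.
by apply; rewrite inE.
Qed.

Lemma chart_inv_cont c x : img c x -> {for x, continuous (chart_inv c)}.
Proof.
move=> cx; have : {within img c, continuous (chart_inv c)} by exact: chart_inv_continuous.
rewrite continuous_open_subspace; last exact: chart_img_open.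
by apply; rewrite inE.
Qed.

Lemma chartK c p : chart_dom c p -> chart_inv c (chart_map c p) = p.
Proof. by move=> cp; apply: chart_mapK; rewrite inE. Qed.

Lemma chart_invP c x : img c x -> chart_dom c (chart_inv c x) /\ chart_map c (chart_inv c x) = x.
Proof. by move=> [p cp <-]; rewrite chartK. Qed.

(** A chart is a homeomorphism onto an open set, so openness can be tested by pulling [A] back along
    [chart_inv c]. *)
Lemma chart_open_image c (A : set M) : open A -> open (chart_map c @` (chart_dom c `&` A)).
Proof.
move=> Ao; rewrite openE => x [p [cp Ap] <-].
have Vx : img c (chart_map c p) by exists p.
have Ainv : \forall y \near chart_map c p, A (chart_inv c y).
  have : nbhs (chart_inv c (chart_map c p)) A by rewrite chartK//; exact: open_nbhs_nbhs.
  by move/(chart_inv_cont Vx).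
have Vn := open_near (@chart_img_open _ _ _ c) Vx.
apply: filterS2 Ainv Vn => y Ay Vy.
by have [h1 h2] := chart_invP Vy; exists (chart_inv c y).
Qed.

Definition chart_ext c (u : 'rV[R]_n -> R) (p : M) : R :=
  if p \in chart_dom c then u (chart_map c p) else 0.

Lemma chart_ext_in c u p : chart_dom c p -> chart_ext c u p = u (chart_map c p).
Proof. by move=> cp; rewrite /chart_ext ifT// inE. Qed.

Lemma chart_ext_out c u p : ~ chart_dom c p -> chart_ext c u p = 0.
Proof. by move=> cp; rewrite /chart_ext ifF//; apply/negP; rewrite inE. Qed.

(** The copy [L] of [K] in [M] is compact, hence closed because [M] is Hausdorff. Any chart [d] is
    then covered by two open pieces: on the overlap with [c] the transition map is smooth, and off
    [L] the extension is zero. *)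
Lemma chart_ext_smooth c (K W : set 'rV[R]_n) u : atlas c -> compact K -> K `<=` W ->
  open W -> W `<=` img c -> smooth_on W u -> (forall x, img c x -> ~ K x -> u x = 0) ->
  smooth (chart_ext c u).
Proof.
move=> Ac Kc KW Wo WV us u0 d Ad k.
have Vo := @chart_img_open _ _ _ c.
have Kcl : closed K by apply: compact_closed => //; exact: norm_hausdorff.
have uV : smooth_on (img c) u.
  move=> l.
  have Oo : open (img c `&` ~` K) by apply: openI => //; exact: closed_openC.
  apply: (@Ck_sub _ _ l _ (W `|` (img c `&` ~` K))).
    by move=> x Vx; have [/KW|] := pselect (K x); [left|right].
  apply: CkU (us l) _; apply: (Ck_ext Oo _ (Ck_cst l 0 Oo)) => x [Vx Kx].
  by rewrite u0.
pose L := chart_inv c @` K.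
have Lcl : closed L.
  apply: compact_closed; first exact: manifold_hausdorff.
  apply: continuous_compact => //.
  have : {within img c, continuous (chart_inv c)} by exact: chart_inv_continuous.
  by apply: continuous_subspaceW; exact: subset_trans WV.
pose O1 := chart_map d @` (chart_dom d `&` chart_dom c).
pose O2 := chart_map d @` (chart_dom d `&` ~` L).
have O1o : open O1 by apply: chart_open_image; exact: chart_dom_open.
have O2o : open O2 by apply: chart_open_image; exact: closed_openC.
apply: (@Ck_sub _ _ k _ (O1 `|` O2)).
  move=> x [p dp <-]; have [cp|cp] := pselect (chart_dom c p); [left|right]; exists p => //.
  by split=> // -[y /KW/WV/chart_invP[yc _] E]; apply: cp; rewrite -E.
apply: CkU.
  apply: (Ck_ext O1o _ (Ck_comp O1o Vo _ (fun j => atlas_compatible Ad Ac j k) (uV k))).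
    by move=> x [p [dp cp] <-] /=; rewrite chartK// chart_ext_in.
  by move=> x [p [dp cp] <-] /=; rewrite chartK//; exists p.
apply: (Ck_ext O2o _ (Ck_cst k 0 O2o)) => x [p [dp Lp] <-] /=.
rewrite chartK//; have [cp|cp] := pselect (chart_dom c p); last by rewrite chart_ext_out.
rewrite chart_ext_in// u0//.
by move=> Kp; apply: Lp; exists (chart_map c p) => //; rewrite chartK.
Qed.

Definition cutoff c (b : 'rV[R]_n -> R) (W : set 'rV[R]_n) :=
  forall u, smooth_on W u -> smooth (chart_ext c (fun x => b x * u x)).

Lemma cutoff_exists c (W : set 'rV[R]_n) q : atlas c -> open W -> W `<=` img c -> W q ->
  exists b, [/\ smooth_on setT b, 0 < b q, forall x, b x != 0 -> W x & cutoff c b W].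
Proof.
move=> Ac Wo WV Wq.
have [r r0 rW] := (nbhs_ballP _ _).1 (open_near Wo Wq).
have [|b [bs bq bK]] := @bump_exists R n q (r / 2); first by rewrite divr_gt0.
(* Half the radius is used so that this closed box still lies inside the open ball contained in
   [W]. *)
pose K := [set x : 'rV[R]_n | forall j, `[q 0 j - r / 2, q 0 j + r / 2]%classic (x 0 j)].
have KW : K `<=` W.
  move=> x Kx; apply: rW; apply: ballrV => // j.
  have := Kx j; rewrite /= in_itv/= => /andP[h1 h2].
  have r2 : 0 < r / 2 by rewrite divr_gt0.
  rewrite ltr_norml; apply/andP; split; lra.
have bK0 x : b x != 0 -> K x.
  move=> b0 j; have := bK x b0 j; rewrite /= in_itv/= ler_norml => /andP[h1 h2].
  by apply/andP; split; lra.
exists b; split=> // [x /bK0/KW//|u us].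
apply: (@chart_ext_smooth c K W) => //.
- by apply: (@rV_compact R n (fun j => `[q 0 j - r / 2, q 0 j + r / 2]%classic)) => j; exact: segment_compact.
- by move=> k; apply: CkM => //; apply: Ck_sub (bs k).
by move=> x _ Kx; have [->|/bK0//] := eqVneq (b x) 0; rewrite mul0r.
Qed.

Lemma smooth_mem (f : M -> R) : smooth f -> f \in @smooth_pred R n M.
Proof. by rewrite inE. Qed.

Lemma Cinf_smooth (f : C) : smooth f.
Proof. by case: f => f /=; rewrite inE. Qed.

Definition mkCinf (f : M -> R) (fs : smooth f) : C := SmoothFun (smooth_mem fs).

Lemma Cinf_ext (f h : C) : (forall p, f p = h p) -> f = h.
Proof. by move=> E; apply/val_inj/funext. Qed.

Lemma CinfD (f h : C) p : (f + h) p = f p + h p. Proof. by []. Qed.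
Lemma CinfN (f : C) p : (- f) p = - f p. Proof. by []. Qed.
Lemma CinfM (f h : C) p : (f * h) p = f p * h p. Proof. by []. Qed.
Lemma CinfZ a (f : C) p : (a *: f) p = a * f p. Proof. by []. Qed.
Lemma Cinf0 p : (0 : C) p = 0. Proof. by []. Qed.
Lemma Cinf1 p : (1 : C) p = 1. Proof. by []. Qed.
Lemma Cinf_sum (I : finType) (F : I -> C) p : (\sum_i F i) p = \sum_i F i p.
Proof. by elim/big_rec2: _ => // i x y _ <-. Qed.

Implicit Types X : VF.

Lemma vf_derivation X : derivation X.
Proof. by case: X => X /=; rewrite inE. Qed.

Lemma vfD X (f h : C) : X (f + h) = X f + X h.
Proof. by have [l _] := vf_derivation X; rewrite -[in LHS](scale1r f) l scale1r. Qed.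

Lemma vf0 X : X 0 = 0.
Proof. by apply: (@addrI _ (X 0)); rewrite -vfD !addr0. Qed.

Lemma vfZ X a (f : C) : X (a *: f) = a *: (X f : C).
Proof. by have [l _] := vf_derivation X; rewrite -[a *: f]addr0 l vf0 addr0. Qed.

Lemma vfM X (f h : C) : X (f * h) = f * X h + h * X f.
Proof. by have [_ m] := vf_derivation X; exact: m. Qed.

Lemma vf_sum X (I : finType) (F : I -> C) : X (\sum_i F i) = \sum_i X (F i).
Proof.
elim: (index_enum I) => [|i s IH]; first by rewrite !big_nil vf0.
by rewrite !big_cons vfD IH.
Qed.

Lemma vf1 X : X 1 = 0.
Proof.
have := vfM X 1 1; rewrite !mul1r => /eqP.
by rewrite -subr_eq0 opprD addNKr oppr_eq0 => /eqP.
Qed.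

Lemma coord_smooth (W : set 'rV[R]_n) (q : 'rV[R]_n) j : open W ->
  smooth_on W (fun x => x 0 j - q 0 j).
Proof. by move=> Wo k; apply: CkD => //; [exact: Ck_coord|exact: Ck_cst]. Qed.

(* Hadamard's expansion of [f] at [p] only holds in a ball; multiplied by the
   square of a bump function it becomes an identity of global functions. *)
Lemma point_derivation c p X : atlas c -> chart_dom c p -> exists a : 'I_n -> R,
  forall f : C, (X f : C) p = \sum_j a j * 'D_(e_ j) (f \o chart_inv c) (chart_map c p).
Proof.
move=> Ac cp; set q := chart_map c p.
have Vq : img c q by exists p.
have [r r0 rV] := (nbhs_ballP _ _).1 (open_near (@chart_img_open _ _ _ c) Vq).
have Wo : open (ball q r) by exact: ball_open.
have Wq : ball q r q by exact: ballxx.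
have [b [bs bq bsupp bW]] := cutoff_exists Ac Wo rV Wq.
pose Y j := mkCinf (bW _ (coord_smooth q j Wo)).
pose z := mkCinf (bW _ (fun k => Ck_cst k 1 Wo)).
(* [Y j] is [b] times the [j]-th coordinate centred at [p], so [X (Y j)] at [p] is [b q] times the
   component of [X]; dividing by [b q] recovers that component. *)
exists (fun j => (X (Y j) : C) p / b q) => f.
have fs : smooth_on (ball q r) (f \o chart_inv c).
  by move=> k; apply: Ck_sub rV _; exact: Cinf_smooth.
have [g [gs gq gE]] := hadamard fs.
pose G j := mkCinf (bW _ (gs j)).
have E : z * z * f = f p *: (z * z) + \sum_j Y j * G j.
  apply: Cinf_ext => p'; rewrite CinfD Cinf_sum !CinfM CinfZ !CinfM.
  have [cp'|cp'] := pselect (chart_dom c p'); last first.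
    rewrite ![z p']chart_ext_out// !mul0r mulr0 add0r big1// => j _.
    by rewrite CinfM [Y j p']chart_ext_out// mul0r.
  rewrite ![z p']chart_ext_in//; set x := chart_map c p'.
  have -> : \sum_j (Y j * G j) p' = b x * b x * \sum_j (x 0 j - q 0 j) * g j x.
    rewrite mulr_sumr; apply: eq_bigr => j _.
    by rewrite CinfM [Y j p']chart_ext_in// [G j p']chart_ext_in// mulrACA.
  have [b0|b0] := eqVneq (b x) 0; first by rewrite b0 !(mul0r, mulr0) addr0.
  have := gE x (bsupp x b0); rewrite /= /x /q !chartK// -/x -/q => ->.
  by rewrite mulr1 mulrDr mulrC.
have := congr1 (fun h : C => (X h : C) p) E.
rewrite vfD vf_sum vfZ !vfM.
rewrite !(CinfD, CinfM, CinfZ, Cinf_sum).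
have zp : z p = b q by rewrite [z p]chart_ext_in// mulr1.
have Yp j : Y j p = 0 by rewrite [Y j p]chart_ext_in// subrr mulr0.
have Gp j : G j p = b q * 'D_(e_ j) (f \o chart_inv c) q by rewrite [G j p]chart_ext_in// gq.
rewrite zp.
have -> : \sum_i (X (Y i * G i) : C) p = b q * \sum_j (X (Y j) : C) p * 'D_(e_ j) (f \o chart_inv c) q.
  rewrite mulr_sumr; apply: eq_bigr => j _; rewrite vfM CinfD !CinfM Yp mul0r add0r Gp.
  by rewrite -mulrA [X in b q * X]mulrC.
have bn0 : b q != 0 by rewrite gt_eqF.
move=> H; under eq_bigr do rewrite mulrAC.
rewrite -mulr_suml; apply: (mulfI bn0); apply: (mulfI bn0).
rewrite [b q * (_ / _)]mulrC divfK//.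
(* The terms from differentiating [z * z] carry the factor [f p] on both sides and cancel. *)
set sm := \sum_j _ in H *; move: H; set A := (X f : C) p; set D := (X z : C) p.
move=> H; have : b q * b q * A = b q * sm by lra.
by rewrite mulrA.
Qed.

End Charts.

(** * Coordinate fields and local frames *)

Section Frames.
Context {R : realType} {n : nat} {M : manifold R n}.
Local Notation C := (Cinf M).
Local Notation VF := (vector_field M).
Local Notation e_ j := (delta_mx 0 j : 'rV[R]_n).
Local Notation img c := (chart_map c @` chart_dom c).
Implicit Types (c d : chart R n M) (p : M) (X U V : VF) (f h : C).

Lemma Cinf_continuous f : continuous (f : M -> R).
Proof.
move=> p; have [c Ac cp] := atlas_cover p.
have Vp : img c (chart_map c p) by exists p.
have H : {for p, continuous ((f \o chart_inv c) \o chart_map c)}.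
  apply: continuous_comp; first exact: chart_map_cont.
  by apply: (Ck_continuous (Cinf_smooth f Ac 0)); rewrite inE.
have E : \forall p' \near p, ((f \o chart_inv c) \o chart_map c) p' = f p'.
  have : \forall p' \near p, chart_dom c p'.
    by apply: open_nbhs_nbhs; split=> //; exact: chart_dom_open.
  by apply: filterS => p' cp' /=; rewrite chartK.
have H' : ((f \o chart_inv c) \o chart_map c) @ p --> f p.
  by rewrite -[in f p](chartK cp); exact: H.
by apply: cvg_trans H'; apply: near_eq_cvg; apply: filterS E => p' ->.
Qed.

Lemma vf_ext X U : (forall f p, (X f : C) p = (U f : C) p) -> X = U.
Proof. by move=> E; apply/val_inj/funext => f; apply: Cinf_ext => p; exact: E. Qed.

Lemma vf_addE X U f p : ((X + U) f : C) p = (X f : C) p + (U f : C) p.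
Proof. by []. Qed.

Lemma vf_scaleE h X f p : ((h *: X) f : C) p = h p * (X f : C) p.
Proof. by []. Qed.

Lemma vf_oppE X f p : ((- X) f : C) p = - (X f : C) p.
Proof. by []. Qed.

Lemma vf_zeroE f p : ((0 : VF) f : C) p = 0.
Proof. by []. Qed.

Lemma vf_sumE (I : finType) (F : I -> VF) f p :
  ((\sum_i F i) f : C) p = \sum_i (F i f : C) p.
Proof.
elim: (index_enum I) => [|i s IH]; first by rewrite !big_nil.
by rewrite !big_cons vf_addE IH.
Qed.

Lemma pull_smooth c f : atlas c -> smooth_on (img c) (f \o chart_inv c).
Proof. by move=> Ac; exact: Cinf_smooth. Qed.

Section ChartFields.
Variables (c : chart R n M) (Ac : atlas c) (b : 'rV[R]_n -> R).
Hypothesis bW : cutoff c b (img c).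

Lemma partial_smooth f j : smooth_on (img c) (fun x => 'D_(e_ j) (f \o chart_inv c) x).
Proof. by move=> k; have [_ /(_ j)[]] := pull_smooth f Ac k.+1. Qed.

Definition partial_fun j f : C^o := mkCinf (bW (partial_smooth f j)).

Lemma partial_funE j f p : chart_dom c p -> (partial_fun j f : C) p =
  b (chart_map c p) * 'D_(e_ j) (f \o chart_inv c) (chart_map c p).
Proof. by move=> cp; rewrite [LHS]chart_ext_in. Qed.

Lemma partial_fun_out j f p : ~ chart_dom c p -> (partial_fun j f : C) p = 0.
Proof. by move=> cp; rewrite [LHS]chart_ext_out. Qed.

Lemma partial_derivation j : partial_fun j \in @derivation_pred R n M.
Proof.
have df f p : chart_dom c p -> derivable (f \o chart_inv c) (chart_map c p) (e_ j).
  move=> cp; have [_ /(_ j)[d _]] := pull_smooth f Ac 1.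
  by apply: d; exists p.
rewrite inE; split=> [a f h|f h]; apply: Cinf_ext => p.
  rewrite CinfD CinfZ.
  have [cp|cp] := pselect (chart_dom c p); last by rewrite !partial_fun_out// mulr0 addr0.
  rewrite !partial_funE//.
  have -> : (a *: f + h : C) \o chart_inv c = (a *: (f \o chart_inv c)) + (h \o chart_inv c) by [].
  rewrite deriveD ?deriveZ//; [|exact: df|by apply: derivableZ; exact: df|exact: df].
  by rewrite mulrDr /GRing.scale/= mulrCA.
rewrite CinfD !CinfM.
have [cp|cp] := pselect (chart_dom c p); last by rewrite !partial_fun_out// !mulr0 addr0.
rewrite !partial_funE//.
have -> : (f * h : C) \o chart_inv c = (f \o chart_inv c) * (h \o chart_inv c) by [].
rewrite deriveM; [|exact: df|exact: df].
by rewrite /GRing.scale/= chartK//; ring.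
Qed.

Definition partial_vf j : VF := VectorField (partial_derivation j).

End ChartFields.

(* With [z] a bump function, [y j] = [z] times the [j]-th coordinate x_j and
   [E j] = [z] times the [j]-th coordinate field, the product rule gives
   [z * U (y j) - y j * U z] = z^2 U(x_j). *)
Lemma local_frame p : exists (z : C) (y : 'I_n -> C) (E : 'I_n -> VF), z p != 0 /\
  forall U, (z * z * z) *: U = \sum_j (z * U (y j) - y j * U z) *: E j.
Proof.
have [c Ac cp] := atlas_cover p.
have Vp : img c (chart_map c p) by exists p.
have Vo := @chart_img_open _ _ _ c.
have [b [bs bq _ bW]] := cutoff_exists Ac Vo (@subset_refl _ _) Vp.
pose z := mkCinf (bW _ (fun k => Ck_cst k 1 Vo)).
have xs j : smooth_on (img c) (fun x : 'rV[R]_n => x 0 j) by move=> k; exact: Ck_coord.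
pose y j := mkCinf (bW _ (xs j)).
exists z, y, (fun j => partial_vf Ac bW j); split.
  by rewrite [z p]chart_ext_in// mulr1 gt_eqF.
move=> U; apply: vf_ext => f p'.
rewrite vf_sumE vf_scaleE !CinfM.
under eq_bigr do rewrite vf_scaleE CinfD CinfN !CinfM.
have [cp'|cp'] := pselect (chart_dom c p'); last first.
  rewrite ![z p']chart_ext_out// !mul0r big1// => j _.
  by rewrite mul0r [y j p']chart_ext_out// mul0r subrr mul0r.
have [a aE] := point_derivation U Ac cp'.
set q := chart_map c p' in aE *.
have Vq : img c q by exists p'.
have zq : z p' = b q by rewrite [z p']chart_ext_in// mulr1.
have yq j : y j p' = b q * q 0 j by rewrite [y j p']chart_ext_in.
have db j : derivable b q (e_ j) by have [_ /(_ j)[+ _]] := bs 1; exact.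
have dx i j : is_derive q (e_ i) (fun x : 'rV[R]_n => x 0 j) ((e_ i) 0 j).
  exact: is_derive_coord.
have nearq := open_near Vo Vq.
have Dz i : 'D_(e_ i) (z \o chart_inv c) q = 'D_(e_ i) b q.
  apply: near_eq_derive; apply: filterS nearq => x /chart_invP[xc xE] /=.
  by rewrite chart_ext_in// xE mulr1.
have Dy i j : 'D_(e_ i) (y j \o chart_inv c) q = b q * (e_ i) 0 j + q 0 j * 'D_(e_ i) b q.
  transitivity ('D_(e_ i) (b * (fun x : 'rV[R]_n => x 0 j)) q).
    apply: near_eq_derive; apply: filterS nearq => x /chart_invP[xc xE] /=.
    by rewrite chart_ext_in// xE.
  have [dxj Dxj] := dx i j.
  by rewrite deriveM// Dxj.
rewrite zq aE mulr_sumr; apply: eq_bigr => j _.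
rewrite [in RHS]partial_funE// -/q aE aE yq.
(* The derivatives of [b] cancel, leaving two factors [b q]; the third factor of the cube comes from
   the cut-off in [E j]. *)
have -> : b q * (\sum_i a i * 'D_(e_ i) (y j \o chart_inv c) q) -
  b q * q 0 j * (\sum_i a i * 'D_(e_ i) (z \o chart_inv c) q) = b q * b q * a j.
  rewrite !mulr_sumr -sumrB (bigD1 j)//= big1 ?addr0 => [|i ij].
    by rewrite Dz Dy mxE !eqxx/=; ring.
  by rewrite Dz Dy mxE eq_sym (negPf ij) andbF/=; ring.
by ring.
Qed.

End Frames.

(** * Unique continuation for linear first order systems *)

Section Propagation.
Context {R : realType} {n : nat} {M : manifold R n}.
Local Notation C := (Cinf M).
Local Notation VF := (vector_field M).
Local Notation e_ j := (delta_mx 0 j : 'rV[R]_n).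
Local Notation img c := (chart_map c @` chart_dom c).

(** Uniqueness for zero initial data, on a ball so small that a maximum argument along rays replaces
    Gronwall's exponential estimate. *)
Lemma gronwall_ball (I : finType) (f : I -> 'rV[R]_n -> R) q r K :
  (forall a, smooth_on (ball q r) (f a)) -> 0 <= K ->
  (forall x, ball q r x -> forall a j, `|'D_(e_ j) (f a) x| <= K * \sum_i `|f i x|) ->
  (forall a, f a q = 0) -> #|I|%:R * n%:R * r * K < 1 ->
  forall x, ball q r x -> forall a, f a x = 0.
Proof.
move=> fs K0 fK fq small x Bx.
have r0 : 0 < r by case: Bx.
have xqr j : `|x 0 j - q 0 j| <= r.
  by case: Bx => _ /(_ 0 j)/ltW; rewrite distrC.
pose g a (t : R) := f a (q + t *: (x - q)).
have dg a (t : R) : 0 <= t <= 1 -> is_derive t (1 : R) (g a)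
    (\sum_j (x 0 j - q 0 j) * 'D_(e_ j) (f a) (q + t *: (x - q))).
  by move=> t01; exact: is_derive_along_ray.
have cg a : cont01 (g a).
  by move=> t /(dg a)[d _]; exact/differentiable_continuous/derivable1_diffP.
pose S t := \sum_a `|g a t|.
have cS : cont01 S.
  move=> t t01; rewrite /S.
  have -> : (fun t => \sum_a `|g a t|) = \sum_a (fun t => `|g a t|).
    by apply/funext => s; rewrite fct_sumE.
  apply: (big_ind (fun h : R -> R => {for t, continuous h})) => [|h1 h2 c1 c2|a _].
  - exact: cvg_cst.
  - exact: cvgD.
  - by apply: cvg_norm; exact: cg.
have [t0 t001 St0] := EVT_max ler01 (cont01_within cS).
have {}t001 : 0 <= t0 <= 1 by rewrite in_itv/= in t001.
have {}St0 t : 0 <= t <= 1 -> S t <= S t0 by move=> t01; apply: St0; rewrite in_itv.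
have S0 t : 0 <= S t by apply: sumr_ge0.
have [t00 t01] := andP t001.
(* On the ray to [x], [S] is at most a constant < 1 times its maximum. *)
have gb a : `|g a t0| <= n%:R * r * K * S t0.
  have [s|s|s st Es] := @MVT_segment R (g a)
     (fun t => \sum_j (x 0 j - q 0 j) * 'D_(e_ j) (f a) (q + t *: (x - q))) 0 t0 t00.
  - rewrite in_itv/= => /andP[s0 st]; apply: dg.
    by rewrite (ltW s0) (le_trans (ltW st)).
  - apply: continuous_subspaceW (cont01_within (cg a)) s => y /=.
    by rewrite !in_itv/= => /andP[-> yt]; exact: le_trans t01.
  have s01 : 0 <= s <= 1.
    by move: st; rewrite in_itv/= => /andP[-> st]; exact: le_trans t01.
  have ga0 : g a 0 = 0 by rewrite /g scale0r addr0.
  move: Es; rewrite ga0 !subr0 => ->; rewrite normrM.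
  apply: (@le_trans _ _ (n%:R * r * K * S s)); last first.
    by rewrite ler_wpM2l ?St0// !mulr_ge0// ltW.
  apply: (@le_trans _ _ `|\sum_j (x 0 j - q 0 j) * 'D_(e_ j) (f a) (q + s *: (x - q))|).
    by rewrite ler_piMr// ger0_norm.
  apply: le_trans (ler_norm_sum _ _ _) _.
  apply: (@le_trans _ _ (\sum_(j < n) r * (K * S s))).
    apply: ler_sum => j _; rewrite normrM ler_pM//.
    by apply: fK; exact: ray_in_ball.
  by rewrite sumr_const card_ord -[leLHS]mulr_natl !mulrA.
have : S t0 <= #|I|%:R * n%:R * r * K * S t0.
  apply: (@le_trans _ _ (\sum_(a : I) n%:R * r * K * S t0)); first exact: ler_sum.
  by rewrite sumr_const -[leLHS]mulr_natl !mulrA.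
rewrite -subr_ge0 -{2}[S t0]mul1r -mulrBl => H.
have St00 : S t0 = 0.
  apply/eqP; rewrite eq_le S0 andbT leNgt; apply/negP => Sp.
  by move: H; rewrite pmulr_lge0// subr_ge0 leNgt small.
move=> a; have : S 1 <= 0 by rewrite -St00 St0// ler01 lexx.
have -> : f a x = g a 1 by rewrite /g scale1r subrKC.
move=> S1; apply/eqP; rewrite -normr_le0; apply: le_trans S1.
by rewrite /S (bigD1 a)//= lerDl; exact: sumr_ge0.
Qed.

(* Uniqueness for a linear first order system, in the frame-free form [z dF = k F]. *)
Lemma zero_locus_open (I : finType) (F : I -> C) (z : C) (p : M) : z p != 0 ->
  (forall (V : VF) a, exists k : I -> C, z * V (F a) = \sum_i k i * F i) ->
  (forall a, F a p = 0) -> \forall p' \near p, forall a, F a p' = 0.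
Proof.
move=> zp H F0.
have [c Ac cp] := atlas_cover p.
set q := chart_map c p.
have Vp : img c q by exists p.
have Vo := @chart_img_open _ _ _ c.
have [b [bs bq _ bW]] := cutoff_exists Ac Vo (@subset_refl _ _) Vp.
have /choice[k kE] : forall w : 'I_n * I, exists k : I -> C,
    z * partial_vf Ac bW w.1 (F w.2) = \sum_i k i * F i.
  by move=> w; exact: H.
(* A lower bound for [b * z] near [q], which lets the system be solved for the partial derivatives
   of the [F a]. *)
pose m := `|b q * z p| / 2.
have bz0 : 0 < `|b q * z p| by rewrite normr_gt0 mulf_neq0// gt_eqF.
have m0 : 0 < m by rewrite divr_gt0.
have pull_cont (f : C) : {for q, continuous (f \o chart_inv c)}.
  by apply: (Ck_continuous (pull_smooth f Ac 0)); rewrite inE.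
have pullq (f : C) : (f \o chart_inv c) q = f p by rewrite /= chartK.
have near_m : \forall x \near q, m < `|b x * (z \o chart_inv c) x|.
  have cbz : {for q, continuous (fun x => b x * (z \o chart_inv c) x)}.
    have cb : {for q, continuous b} by apply: (Ck_continuous (bs 0)); rewrite inE.
    exact: cvgM cb (pull_cont z).
  have cn : `|b x * (z \o chart_inv c) x| @[x --> q] --> `|b q * (z \o chart_inv c) q|.
    exact: (cvg_norm (FF := nbhs_filter q) cbz).
  apply: (cvgr_gt _ cn).
  by rewrite pullq /m ltr_pdivrMr// ltr_pMr// ltr1n.
have near_k : \forall x \near q, forall w : 'I_n * I * I,
    `|(k w.1 w.2 \o chart_inv c) x| <= `|k w.1 w.2 p| + 1.
  apply: (@filter_forall _ _ _ (nbhs q) (nbhs_filter q)) => w.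
  have cn : `|(k w.1 w.2 \o chart_inv c) x| @[x --> q] --> `|(k w.1 w.2 \o chart_inv c) q|.
    exact: (cvg_norm (FF := nbhs_filter q) (pull_cont _)).
  apply: (cvgr_le _ cn).
  by rewrite pullq ltrDl.
have near_V := open_near Vo Vp.
(* Adding the bounds over all index triples gives a single bound for every coefficient near [q]. *)
pose K0 := \sum_(w : 'I_n * I * I) (`|k w.1 w.2 p| + 1).
have K00 : 0 <= K0 by apply: sumr_ge0 => w _; rewrite addr_ge0.
pose K := K0 / m.
have KK : 0 <= K by rewrite divr_ge0// ltW.
have [r r0 rB] := (nbhs_ballP _ _).1 (filterI near_m (filterI near_k near_V)).
pose L := #|I|%:R * n%:R * K.
have L0 : 0 <= L.
  by rewrite /L; apply: mulr_ge0 => //; apply: mulr_ge0; exact: ler0n.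
(* With this radius the contraction constant is at most [L / (1 + L)], hence less than 1; the
   summand 1 also takes care of [L = 0]. *)
pose r' := Num.min r (1 + L)^-1.
have r'0 : 0 < r' by rewrite lt_min r0 invr_gt0 ltr_wpDr.
have r'r : r' <= r by rewrite ge_min lexx.
have r'L : #|I|%:R * n%:R * r' * K < 1.
  have -> : #|I|%:R * n%:R * r' * K = L * r' by rewrite /L; ring.
  apply: (@le_lt_trans _ _ (L * (1 + L)^-1)).
    by rewrite ler_wpM2l// ge_min lexx orbT.
  by rewrite ltr_pdivrMr ?ltr_wpDr// mul1r ltrDr.
have sub : ball q r' `<=` ball q r by exact: le_ball.
have key : forall x, ball q r' x -> forall a, (F a \o chart_inv c) x = 0.
  apply: (gronwall_ball (K := K)) r'L => //.
  - by move=> a l; apply: Ck_sub (pull_smooth (F a) Ac l) => x /sub/rB[_ []].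
  - move=> x /sub/rB[mx [kx Vx]] a j.
    have [cx xE] := chart_invP Vx.
    have := congr1 (fun h : C => h (chart_inv c x)) (kE (j, a)).
    rewrite CinfM partial_funE// Cinf_sum xE /= => E.
    rewrite /K mulrAC ler_pdivlMr//.
    apply: (@le_trans _ _ `|\sum_i (k (j, a) i * F i) (chart_inv c x)|).
      rewrite -E mulrA [z _ * _]mulrC normrM [leLHS]mulrC; apply: ler_wpM2r => //.
      exact: ltW.
    apply: le_trans (ler_norm_sum _ _ _) _; rewrite mulr_sumr.
    apply: ler_sum => i _; rewrite CinfM normrM ler_wpM2r//.
    apply: le_trans (kx (j, a, i)) _ => /=.
    rewrite /K0 (bigD1 (j, a, i))//= lerDl; apply: sumr_ge0 => w _.
    by rewrite addr_ge0.
  - by move=> a; rewrite pullq.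
have nb : \forall p' \near p, ball q r' (chart_map c p').
  by apply: (chart_map_cont cp); exact: nbhsx_ballx.
have nd : \forall p' \near p, chart_dom c p'.
  by apply: open_nbhs_nbhs; split=> //; exact: chart_dom_open.
apply: filterS2 nb nd => p' Bp' dp' a.
by have := key _ Bp' a; rewrite /= chartK.
Qed.

End Propagation.

(** * Levi-Civita connection and curvature *)

Section MetricAlgebra.
Context {R : realType} {n : nat} {M : manifold R n}.
Local Notation C := (Cinf M).
Local Notation VF := (vector_field M).
Variable g : metric M.
Implicit Types (X Y Z U V W : VF) (f h : C) (p : M).

Lemma metricDl U V W : g (U + V) W = g U W + g V W.
Proof. by rewrite -[U]scale1r metric_linear mul1r scale1r. Qed.

Lemma metric0l W : g 0 W = 0.
Proof. by apply: (@addrI _ (g 0 W)); rewrite -metricDl !addr0. Qed.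

Lemma metricZl f U W : g (f *: U) W = f * g U W.
Proof. by rewrite -[f *: U]addr0 metric_linear metric0l addr0. Qed.

Lemma metricNl U W : g (- U) W = - g U W.
Proof. by apply: (@addrI _ (g U W)); rewrite -metricDl !subrr metric0l. Qed.

Lemma metricDr U V W : g W (U + V) = g W U + g W V.
Proof. by rewrite Defs.metric_sym metricDl (Defs.metric_sym _ U) (Defs.metric_sym _ V). Qed.

Lemma metricZr f U W : g W (f *: U) = f * g W U.
Proof. by rewrite Defs.metric_sym metricZl (Defs.metric_sym _ U). Qed.

Lemma metricNr U W : g W (- U) = - g W U.
Proof. by rewrite Defs.metric_sym metricNl (Defs.metric_sym _ U). Qed.

Lemma metric_suml (I : finType) (F : I -> VF) W : g (\sum_i F i) W = \sum_i g (F i) W.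
Proof.
elim: (index_enum I) => [|i s IH]; first by rewrite !big_nil metric0l.
by rewrite !big_cons metricDl IH.
Qed.

Definition Clinear (L : VF -> C) := forall f U V, L (f *: U + V) = f * L U + L V.

Lemma ClinearD L U V : Clinear L -> L (U + V) = L U + L V.
Proof. by move=> lL; rewrite -[U]scale1r lL mul1r scale1r. Qed.

Lemma Clinear0 L : Clinear L -> L 0 = 0.
Proof. by move=> lL; apply: (@addrI _ (L 0)); rewrite -ClinearD// !addr0. Qed.

Lemma ClinearZ L f U : Clinear L -> L (f *: U) = f * L U.
Proof. by move=> lL; rewrite -[f *: U]addr0 lL Clinear0// addr0. Qed.

Lemma Clinear_sum L (I : finType) (F : I -> VF) : Clinear L -> L (\sum_i F i) = \sum_i L (F i).
Proof.
move=> lL; elim: (index_enum I) => [|i s IH]; first by rewrite !big_nil Clinear0.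
by rewrite !big_cons ClinearD// IH.
Qed.

Lemma metric_Clinear W : Clinear (fun U => g U W).
Proof. by move=> f U V; rewrite metric_linear. Qed.

(** Linearity over smooth functions makes [L] pointwise: the frame coefficients of [U] are
    combinations of [U (y j)] and [U z], which vanish at [p]. *)
Lemma Clinear_vanish L U p : Clinear L -> vanishes_at U p -> L U p = 0.
Proof.
move=> lL Up; have [z [y [E [zp zE]]]] := local_frame p.
have := congr1 (fun h : C => h p) (congr1 L (zE U)).
rewrite ClinearZ// Clinear_sum// Cinf_sum !CinfM big1 => [|j _].
  by move/eqP; rewrite !mulf_eq0 !orbb (negPf zp) => /eqP.
by rewrite ClinearZ// CinfM CinfD CinfN !CinfM !Up !mulr0 subrr mul0r.
Qed.

Lemma metric_vanish U W p : vanishes_at U p -> g U W p = 0.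
Proof. exact: (Clinear_vanish (metric_Clinear W)). Qed.

Lemma metric_self_vanish U p : g U U p = 0 -> vanishes_at U p.
Proof.
move=> U0; apply: contrapT => /(metric_pos g); by rewrite U0 ltxx.
Qed.

Lemma metric_nondegenerate U : (forall p, g U U p = 0) -> U = 0.
Proof. by move=> U0; apply: vf_ext => f p; rewrite vf_zeroE; exact: metric_self_vanish. Qed.

(** The frame coefficients of [n + 1] fields form a matrix with a nonzero left kernel; pairing the
    resulting linear relation at [p] with [X k] kills its [k]-th coefficient. *)
Lemma no_orthogonal_family (X : 'I_n.+1 -> VF) p :
  (forall i j, i != j -> g (X i) (X j) p = 0) -> (forall i, g (X i) (X i) p != 0) -> False.
Proof.
move=> orth nz; have [z [y [E [zp zE]]]] := local_frame p.
pose m : 'M[R]_(n.+1, n) := \matrix_(i, j) (z * X i (y j) - y j * X i z : C) p.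
have : kermx m != 0.
  rewrite -mxrank_eq0 mxrank_ker -lt0n subn_gt0 ltnS; exact: rank_leq_col.
case/rowV0Pn => v /sub_kermxP vm /eqP; apply; apply/rowP => k; rewrite mxE.
have : \sum_i v 0 i * g ((z * z * z) *: X i) (X k) p = 0.
  transitivity (\sum_j (v *m m) 0 j * g (E j) (X k) p).
    under [RHS]eq_bigr do rewrite mxE mulr_suml.
    rewrite exchange_big; apply: eq_bigr => i _ /=.
    rewrite zE metric_suml Cinf_sum mulr_sumr; apply: eq_bigr => j _.
    by rewrite metricZl CinfM mxE mulrA.
  by rewrite vm big1// => j _; rewrite mxE mul0r.
rewrite (bigD1 k)//= big1 => [|i ik]; last by rewrite metricZl CinfM (orth _ _ ik) !mulr0.
rewrite addr0 metricZl !CinfM => /eqP; rewrite !mulf_eq0 !orbb (negPf zp) (negPf (nz k)).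
by rewrite /= orbF => /eqP.
Qed.

Section LeviCivita.
Variable nabla : VF -> VF -> VF.
Hypothesis LC : levi_civita g nabla.
Local Notation Rm := (curvature nabla).
Local Notation DRm := (nabla_curvature nabla).

Lemma nabla_linear1 f X Y Z : nabla (f *: X + Y) Z = f *: nabla X Z + nabla Y Z.
Proof. by case: LC. Qed.
Lemma nablaDr X Y Z : nabla X (Y + Z) = nabla X Y + nabla X Z.
Proof. by case: LC. Qed.
Lemma nabla_leibniz X f Y : nabla X (f *: Y) = (X f : C) *: Y + f *: nabla X Y.
Proof. by case: LC. Qed.
Lemma nabla_torsion_free X Y : bracket X Y = nabla X Y - nabla Y X.
Proof. by case: LC. Qed.
Lemma nabla_metric X Y Z : X (g Y Z) = g (nabla X Y) Z + g Y (nabla X Z).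
Proof. by case: LC. Qed.

Lemma nablaDl X Y Z : nabla (X + Y) Z = nabla X Z + nabla Y Z.
Proof. by rewrite -[X]scale1r nabla_linear1 !scale1r. Qed.
Lemma nabla0l Z : nabla 0 Z = 0.
Proof. by apply: (@addrI _ (nabla 0 Z)); rewrite -nablaDl !addr0. Qed.
Lemma nablaZl f X Z : nabla (f *: X) Z = f *: nabla X Z.
Proof. by rewrite -[f *: X]addr0 nabla_linear1 nabla0l addr0. Qed.
Lemma nablaNl X Z : nabla (- X) Z = - nabla X Z.
Proof. by apply: (@addrI _ (nabla X Z)); rewrite -nablaDl !subrr nabla0l. Qed.
Lemma nabla0r X : nabla X 0 = 0.
Proof. by apply: (@addrI _ (nabla X 0)); rewrite -nablaDr !addr0. Qed.
Lemma nablaNr X Z : nabla X (- Z) = - nabla X Z.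
Proof. by apply: (@addrI _ (nabla X Z)); rewrite -nablaDr !subrr nabla0r. Qed.

Lemma curvature_anti X Y Z : Rm Y X Z = - Rm X Y Z.
Proof.
have E : bracket Y X = - bracket X Y by rewrite !nabla_torsion_free opprB.
rewrite /curvature E nablaNl; apply: vf_ext => h p.
by rewrite !(vf_addE, vf_oppE); ring.
Qed.

(** The derivative of [f] produced by the Leibniz rule in [nabla Y] is cancelled by the extra term
    of the bracket. *)
Lemma curvature_lin1 f X X' Y Z : Rm (f *: X + X') Y Z = f *: Rm X Y Z + Rm X' Y Z.
Proof.
have E : bracket (f *: X + X') Y = f *: bracket X Y + bracket X' Y - (Y f : C) *: X.
  rewrite !nabla_torsion_free nabla_linear1 nablaDr nabla_leibniz; apply: vf_ext => h p.
  by rewrite !(vf_addE, vf_oppE, vf_scaleE); ring.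
rewrite /curvature E !(nabla_linear1, nablaDl, nablaDr, nablaNl, nablaZl, nabla_leibniz); apply: vf_ext => h p.
by rewrite !(vf_addE, vf_oppE, vf_scaleE); ring.
Qed.

Lemma curvature_lin2 f X Y Y' Z : Rm X (f *: Y + Y') Z = f *: Rm X Y Z + Rm X Y' Z.
Proof. by rewrite curvature_anti curvature_lin1 opprD -scalerN -!curvature_anti. Qed.

Lemma bracketE X Y f p : (bracket X Y f : C) p = (X (Y f) : C) p - (Y (X f) : C) p.
Proof. by []. Qed.

Lemma curvature_lin3 f X Y Z Z' : Rm X Y (f *: Z + Z') = f *: Rm X Y Z + Rm X Y Z'.
Proof.
rewrite /curvature !(nabla_linear1, nablaDl, nablaDr, nablaNl, nablaZl, nabla_leibniz); apply: vf_ext => h p.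
by rewrite !(vf_addE, vf_oppE, vf_scaleE) bracketE; ring.
Qed.

(** Metric compatibility expands both second derivatives of [g Z W] and its derivative along
    [bracket X Y]; in the commutator identity the mixed terms cancel. *)
Lemma curvature_skew X Y Z W : g (Rm X Y Z) W = - g Z (Rm X Y W).
Proof.
have E U V : U (V (g Z W)) = g (nabla U (nabla V Z)) W + g (nabla V Z) (nabla U W) +
    (g (nabla U Z) (nabla V W) + g Z (nabla U (nabla V W))).
  by rewrite nabla_metric vfD !nabla_metric.
apply: Cinf_ext => p.
have E1 := congr1 (fun h : C => h p) (E X Y).
have E2 := congr1 (fun h : C => h p) (E Y X).
have E3 := congr1 (fun h : C => h p) (nabla_metric (bracket X Y) Z W).
move: E3; rewrite bracketE E1 E2 /curvature !(metricDl, metricNl, metricDr, metricNr) !(CinfD, CinfN).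
lra.
Qed.

(** Differentiate the skewness of [Q X Y] along [W]; the corrections from [nabla W X] and
    [nabla W Y] are themselves skew. *)
Lemma covariant_derivative_skew (Q : VF -> VF -> VF -> VF) :
  (forall X Y Z W, g (Q X Y Z) W = - g Z (Q X Y W)) -> forall W X Y Z V,
  let DQ U := nabla W (Q X Y U) - Q (nabla W X) Y U - Q X (nabla W Y) U - Q X Y (nabla W U) in
  g (DQ Z) V = - g Z (DQ V).
Proof.
move=> Qs W X Y Z V /=.
have c1 := nabla_metric W (Q X Y Z) V; have c2 := nabla_metric W Z (Q X Y V).
have := congr1 W (Qs X Y Z V).
have -> : - g Z (Q X Y V) = (-1) *: g Z (Q X Y V) by rewrite scaleN1r.
rewrite vfZ c1 c2 => H; apply: Cinf_ext => p.
have {H} := congr1 (fun h : C => h p) H.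
rewrite !(metricDl, metricNl, metricDr, metricNr) !(CinfD, CinfN, CinfZ).
have S1 U U' : g (Q U U' Z) V p = - g Z (Q U U' V) p by rewrite Qs.
have S2 : g (Q X Y Z) (nabla W V) p = - g Z (Q X Y (nabla W V)) p by rewrite Qs.
have S3 : g (Q X Y (nabla W Z)) V p = - g (nabla W Z) (Q X Y V) p by rewrite Qs.
rewrite !S1 S2 S3; lra.
Qed.

Lemma nabla_curvature_skew W X Y Z V : g (DRm W X Y Z) V = - g Z (DRm W X Y V).
Proof. exact: covariant_derivative_skew curvature_skew W X Y Z V. Qed.

End LeviCivita.
End MetricAlgebra.

(** * Parallel tensors on a connected manifold *)

Section ParallelTensor.
Context {R : realType} {n : nat} {M : manifold R n}.
Local Notation C := (Cinf M).
Local Notation VF := (vector_field M).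
Implicit Types (X Y Z U V W : VF) (f h : C) (p : M).

Lemma Cinf_neq0_near f p : f p != 0 -> \forall p' \near p, f p' != 0.
Proof. by move=> fp; apply: (cvgr_neq0 _ (@Cinf_continuous R n M f p)). Qed.

Definition Cspan (I : finType) (F : I -> C) h := exists k : I -> C, h = \sum_i k i * F i.

Lemma CspanD (I : finType) (F : I -> C) f h : Cspan F f -> Cspan F h -> Cspan F (f + h).
Proof.
move=> [k ->] [l ->]; exists (fun i => k i + l i).
by rewrite -big_split; apply: eq_bigr => i _; rewrite mulrDl.
Qed.

Lemma CspanM (I : finType) (F : I -> C) f h : Cspan F h -> Cspan F (f * h).
Proof.
move=> [l ->]; exists (fun i => f * l i).
by rewrite mulr_sumr; apply: eq_bigr => i _; rewrite mulrA.
Qed.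

Lemma Cspan_gen (I : finType) (F : I -> C) i : Cspan F (F i).
Proof.
exists (fun j => (j == i)%:R); rewrite (bigD1 i)//= eqxx mul1r big1 ?addr0// => j ji.
by rewrite (negPf ji) mul0r.
Qed.

Lemma Cspan_sum (I : finType) (F : I -> C) (J : finType) (G : J -> C) :
  (forall j, Cspan F (G j)) -> Cspan F (\sum_j G j).
Proof.
move=> FG; apply: (big_ind (Cspan F)) => //; last exact: CspanD.
by exists (fun=> 0); rewrite big1// => i _; rewrite mul0r.
Qed.

(** The zero set contains [p0], is closed by continuity, and is open by [zero_locus_open] for the
    components in a local frame, parallelism being a linear first order system for them.
    Connectedness concludes. *)
Lemma parallel_tensor_vanish (nabla : VF -> VF -> VF) (q : VF -> VF -> VF -> VF -> C) p0 :
  (forall Y Z W, Clinear (fun X => q X Y Z W)) ->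
  (forall X Z W, Clinear (fun Y => q X Y Z W)) ->
  (forall X Y W, Clinear (fun Z => q X Y Z W)) ->
  (forall X Y Z, Clinear (fun W => q X Y Z W)) ->
  (forall V X Y Z W, V (q X Y Z W) = q (nabla V X) Y Z W + q X (nabla V Y) Z W +
     q X Y (nabla V Z) W + q X Y Z (nabla V W)) ->
  (forall X Y Z W, q X Y Z W p0 = 0) -> forall p X Y Z W, q X Y Z W p = 0.
Proof.
move=> l1 l2 l3 l4 par q0.
pose P := [set p : M | forall X Y Z W, q X Y Z W p = 0].
suff PT : P = [set: M] by move=> p; have : P p by rewrite PT.
apply: (@manifold_connected R n M) => //.
- by exists p0.
- exists P; last by rewrite setTI.
  rewrite openE => p Pp.
  have [z [y [E [zp zE]]]] := local_frame p.
  pose F (a : 'I_n * 'I_n * 'I_n * 'I_n) := q (E a.1.1.1) (E a.1.1.2) (E a.1.2) (E a.2).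
  have expand (L : VF -> C) U : Clinear L ->
      z * z * z * L U = \sum_j (z * U (y j) - y j * U z) * L (E j).
    move=> lL; rewrite -(ClinearZ _ _ lL) zE (Clinear_sum _ lL).
    by apply: eq_bigr => j _; rewrite (ClinearZ _ _ lL).
  have span (L : VF -> C) U : Clinear L -> (forall j, Cspan F (L (E j))) ->
      Cspan F (z * z * z * L U).
    by move=> lL LE; rewrite expand//; apply: Cspan_sum => j; exact: CspanM.
  have open_F := @zero_locus_open R n M _ F (z * z * z) p.
  have zzz : (z * z * z : C) p != 0 by rewrite !CinfM !mulf_neq0.
  have nearF := open_F zzz _ (fun a => Pp _ _ _ _).
  have {}nearF : \forall p' \near p, forall a, F a p' = 0.
    (* By [par] the derivative of a component is a sum of four values of [q], each with one frame
       field replaced by its covariant derivative; multiplied by the cube of [z], each of them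
       expands in components. *)
    apply: nearF => V [[[i j] k] l]; apply: (_ : Cspan F _).
    rewrite {2}/F par !mulrDr /=; do ![apply: CspanD].
    + by apply: (span (fun X => q X (E j) (E k) (E l))) => // m; exact: (Cspan_gen F (m, j, k, l)).
    + by apply: (span (fun X => q (E i) X (E k) (E l))) => // m; exact: (Cspan_gen F (i, m, k, l)).
    + by apply: (span (fun X => q (E i) (E j) X (E l))) => // m; exact: (Cspan_gen F (i, j, m, l)).
    + by apply: (span (fun X => q (E i) (E j) (E k) X)) => // m; exact: (Cspan_gen F (i, j, k, m)).
  apply: filterS2 nearF (Cinf_neq0_near zp) => p' F0 zp'.
  (* At points near [p] where [z] is still nonzero, a linear form that vanishes on the frame fields
     vanishes on all fields. *)
  have red (L : VF -> C) U : Clinear L -> (forall j, L (E j) p' = 0) -> L U p' = 0.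
    move=> lL L0; have := congr1 (fun h : C => h p') (expand L U lL).
    rewrite !CinfM Cinf_sum big1 => [|j _]; last by rewrite CinfM L0 mulr0.
    by move/eqP; rewrite !mulf_eq0 !orbb (negPf zp') => /eqP.
  move=> X Y Z W.
  apply: (red (fun X => q X Y Z W)) => // i.
  apply: (red (fun Y => q (E i) Y Z W)) => // j.
  apply: (red (fun Z => q (E i) (E j) Z W)) => // k.
  apply: (red (fun W => q (E i) (E j) (E k) W)) => // l.
  exact: (F0 (i, j, k, l)).
exists P; last by rewrite setTI.
rewrite -[P]setCK; apply: open_closedC; rewrite openE => p nPp.
have : exists w : VF * VF * VF * VF, q w.1.1.1 w.1.1.2 w.1.2 w.2 p != 0.
  apply: contrapT => nE; apply: nPp => X Y Z W; apply/eqP/negPn/negP => nq.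
  by apply: nE; exists (X, Y, Z, W).
move=> [[[[X Y] Z] W]] /Cinf_neq0_near; apply: filterS => p' /= /eqP qn Pp'.
exact: qn.
Qed.

End ParallelTensor.

Section Sub3.
Context {R : realType} {n : nat} {M : manifold R n}.
Variable g : metric M.
Implicit Types (a b c d U : vector_field M).

Lemma metric_sub3l a b c d U p : g (a - b - c - d) U p = g a U p - g b U p - g c U p - g d U p.
Proof. by rewrite !metricDl !metricNl. Qed.

Lemma metric_add3l a b c U : g (a + b + c) U = g a U + g b U + g c U.
Proof. by rewrite !metricDl. Qed.

Lemma sub3_eq0 (T : zmodType) (a b c d : T) : a - b - c - d = 0 -> a = b + c + d.
Proof. by move=> H; apply/eqP; rewrite -subr_eq0 !opprD !addrA H. Qed.

End Sub3.

(** * Recurrent contact metric 3-manifolds *)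

Section Contact.
Context {R : realType} {M : manifold R 3}.
Local Notation C := (Cinf M).
Local Notation VF := (vector_field M).
Implicit Types (X Y Z U V W : VF) (f h : C) (p : M).
Variables (S : contact_metric M) (nabla : VF -> VF -> VF).
Hypothesis LC : levi_civita (cm_g S) nabla.
Local Notation g := (cm_g S).
Local Notation eta := (cm_eta S).
Local Notation xi := (cm_xi S).
Local Notation Rm := (curvature nabla).

Lemma metric_xi_xi : g xi xi = 1.
Proof. by rewrite -cm_eta_g cm_eta_xi. Qed.

Lemma ext_d_nonzero p : exists X Y, ext_d eta X Y p != 0.
Proof.
apply: contrapT => H.
have H0 X Y : ext_d eta X Y p = 0.
  by apply/eqP/negPn/negP => nz; apply: H; exists X, Y.
have [X [Y [Z]]] := cm_contact S p; apply.
by rewrite CinfZ !CinfD !CinfM !H0 !mulr0 !addr0 mulr0.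
Qed.

(** The derivative of the constant [g xi xi] is zero. *)
Lemma nabla_xi_perp W : g (nabla W xi) xi = 0.
Proof.
have := nabla_metric LC W xi xi; rewrite metric_xi_xi.
rewrite vf1 (Defs.metric_sym g xi) => H; apply: Cinf_ext => p.
have := congr1 (fun h : C => h p) H; rewrite CinfD Cinf0; lra.
Qed.

(** Torsion-freeness and metric compatibility turn the exterior derivative into the antisymmetric
    part of [nabla xi]. This is how the contact condition keeps [nabla xi] from vanishing at a
    point. *)
Lemma ext_d_nabla X Y p :
  ext_d eta X Y p = 2^-1 * (g Y (nabla X xi) p - g X (nabla Y xi) p).
Proof.
rewrite CinfZ !(CinfD, CinfN) !cm_eta_g.
have c1 := congr1 (fun h : C => h p) (nabla_metric LC X Y xi).
have c2 := congr1 (fun h : C => h p) (nabla_metric LC Y X xi).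
rewrite (nabla_torsion_free LC) metricDl metricNl CinfD CinfN; congr (_ * _).
move: c1 c2; rewrite !CinfD; lra.
Qed.

Lemma nabla_xi_nonzero p : exists W, ~ vanishes_at (nabla W xi) p.
Proof.
have [X [Y]] := ext_d_nonzero p; rewrite ext_d_nabla => nz.
apply: contrapT => H.
have V0 W U : g U (nabla W xi) p = 0.
  rewrite Defs.metric_sym; apply: metric_vanish.
  by apply: contrapT => nv; apply: H; exists W.
by move: nz; rewrite !V0 subrr mulr0 eqxx.
Qed.

Section Recurrent.
Variables (A : one_form M).
Hypothesis rec : forall X Y Z W, cm_phi S (cm_phi S (nabla_curvature nabla W X Y Z))
      = (A W : C) *: curvature nabla X Y Z.
Local Notation DRm := (nabla_curvature nabla).

Lemma recurrence_at W X Y Z V p :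
  - g (DRm W X Y Z) V p + g (DRm W X Y Z) xi p * g xi V p = (A W : C) p * g (Rm X Y Z) V p.
Proof.
have := congr1 (fun U => g U V p) (rec X Y Z W).
by rewrite cm_phi2 metricDl metricNl !metricZl !(CinfD, CinfN, CinfM) cm_eta_g.
Qed.

(** The image of the square of [cm_phi S] is orthogonal to [xi], so the left side of the recurrence
    drops out. *)
Lemma curvature_xi W X Y Z p : (A W : C) p * g (Rm X Y Z) xi p = 0.
Proof. by rewrite -recurrence_at metric_xi_xi Cinf1 mulr1 addNr. Qed.

Lemma curvature_nabla_xi W0 W X Y V p : (A W0 : C) p != 0 ->
  g (Rm X Y (nabla W xi)) V p = 0.
Proof.
move=> a0.
have Rxi X' Y' Z' : g (Rm X' Y' Z') xi p = 0.
  by apply: (mulfI a0); rewrite curvature_xi mulr0.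
have Rxi' X' Y' Z' : g (Rm X' Y' xi) Z' p = 0.
  by rewrite curvature_skew// CinfN Defs.metric_sym Rxi oppr0.
(* Vanishing at the single point [p] cannot be differentiated. Instead the product with [A W0], zero
   everywhere, is differentiated, and the term containing the derivative of [A W0] vanishes at
   [p]. *)
have WR U : (W (g (Rm X Y xi) U) : C) p = 0.
  have aR : A W0 * g (Rm X Y xi) U = 0.
    apply: Cinf_ext => p'; rewrite CinfM curvature_skew// CinfN mulrN Defs.metric_sym.
    by rewrite curvature_xi oppr0.
  have := congr1 (fun h : C => (W h : C) p) aR.
  rewrite vfM vf0 CinfD !CinfM Rxi' mul0r addr0 Cinf0 => /eqP.
  by rewrite mulf_eq0 (negPf a0) => /eqP.
(* Of the four terms of [DRm W X Y xi] only the last one survives at [p]. *)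
have D U : g (DRm W X Y xi) U p = - g (Rm X Y (nabla W xi)) U p.
  have := WR U; rewrite (nabla_metric LC) CinfD Rxi' addr0 => E.
  by rewrite metric_sub3l E (Rxi' (nabla W X)) (Rxi' X (nabla W Y)) !subr0 add0r.
have := recurrence_at W X Y xi V p.
by rewrite !D Rxi oppr0 mul0r addr0 opprK Rxi' mulr0.
Qed.

(* Where [A] does not vanish, xi, V = nabla_W xi, Q = R(X,Y)Z and Q' = R(X,Y)Q
   are pairwise orthogonal; V can be chosen nonzero since d eta is nonzero, so
   in dimension 3 either Q or Q' is zero, and g(Q,Q) = - g(Z,Q'). *)
Lemma curvature_killed W0 X Y Z : (A W0 : C) *: Rm X Y Z = 0.
Proof.
apply: (metric_nondegenerate (g := g)) => p; rewrite metricZl metricZr !CinfM.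
have [->|a0] := eqVneq ((A W0 : C) p) 0; first by rewrite !mul0r.
suff -> : g (Rm X Y Z) (Rm X Y Z) p = 0 by rewrite !mulr0.
have [W nW] := nabla_xi_nonzero p.
set Q := Rm X Y Z; set V := nabla W xi in nW; pose Q' := Rm X Y Q.
have Rxi X' Y' Z' : g (Rm X' Y' Z') xi p = 0.
  by apply: (mulfI a0); rewrite curvature_xi mulr0.
have RV Z' : g (Rm X Y Z') V p = 0.
  by rewrite curvature_skew// CinfN Defs.metric_sym (curvature_nabla_xi _ _ _ _ a0) oppr0.
have QQ' : g Q' Q p = 0.
  have := congr1 (fun h : C => h p) (curvature_skew LC X Y Q Q).
  by rewrite CinfN [g Q _]Defs.metric_sym -/Q'; lra.
apply: contrapT => /eqP QQ.
have Q'Q' : g Q' Q' p != 0.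
  apply/negP => /eqP/metric_self_vanish Q'v; move: QQ.
  rewrite {1}/Q curvature_skew// CinfN Defs.metric_sym -/Q' metric_vanish// oppr0.
  by rewrite eqxx.
pose F (i : 'I_4) : VF := [:: xi; V; Q; Q']`_i.
have Vxi : g V xi p = 0 by rewrite nabla_xi_perp.
apply: (@no_orthogonal_family R 3 M g F p) => [i j|i].
  suff lt (i' j' : 'I_4) : (i' < j')%N -> g (F j') (F i') p = 0.
    rewrite neq_ltn => /orP[|]; last exact: lt.
    by rewrite Defs.metric_sym; exact: lt.
  case: i' j' => -[|[|[|[|//]]]] ? [[|[|[|[|//]]]] ?] //= _.
  - exact: Rxi.
  - exact: Rxi.
  - exact: RV.
  - exact: RV.
case: i => -[|[|[|[|//]]]] ? //=.
  by rewrite /F/= metric_xi_xi Cinf1 oner_eq0.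
by apply/negP => /eqP/metric_self_vanish.
Qed.

Lemma curvature_parallel W X Y Z : DRm W X Y Z = 0.
Proof.
have T U : g (DRm W X Y Z) U = g (DRm W X Y Z) xi * g xi U.
  apply: Cinf_ext => p; have := recurrence_at W X Y Z U p.
  have := congr1 (fun V => g V U p) (curvature_killed W X Y Z).
  rewrite metricZl metric0l !CinfM Cinf0 => ->; lra.
have Txi : g (DRm W X Y xi) xi = 0.
  apply: Cinf_ext => p.
  have := congr1 (fun h : C => h p) (nabla_curvature_skew LC W X Y xi xi).
  by rewrite CinfN [g xi _]Defs.metric_sym Cinf0; lra.
(* Skewness passes to [DRm W X Y xi], which is a multiple of [xi] and by [Txi] has no component
   along it. *)
have Tz : g (DRm W X Y Z) xi = 0.
  rewrite nabla_curvature_skew// [g Z _]Defs.metric_sym.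
  apply: Cinf_ext => p; have := recurrence_at W X Y xi Z p.
  have := congr1 (fun V => g V Z p) (curvature_killed W X Y xi).
  rewrite metricZl metric0l !CinfM CinfN Cinf0 => -> ; rewrite Txi Cinf0; lra.
by apply: (metric_nondegenerate (g := g)) => p; rewrite T Tz mul0r.
Qed.

Lemma curvature_flat : (exists X, A X <> 0) -> forall X Y Z, Rm X Y Z = 0.
Proof.
move=> [W0 AW0].
(* One point where [A] is nonzero suffices: there the curvature vanishes by [curvature_killed], and
   being parallel it then vanishes on all of [M]. *)
have [p0 a0] : exists p0, (A W0 : C) p0 != 0.
  apply: contrapT => H; apply: AW0; apply: Cinf_ext => p.
  by apply/eqP/negPn/negP => nz; apply: H; exists p.
have key := @parallel_tensor_vanish R 3 M nabla (fun X Y Z W => g (Rm X Y Z) W) p0.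
move=> X Y Z; apply: (metric_nondegenerate (g := g)) => p; apply: key.
- by move=> Y' Z' W f U V; rewrite (curvature_lin1 LC) metric_linear.
- by move=> Y' Z' W f U V; rewrite (curvature_lin2 LC) metric_linear.
- by move=> Y' Z' W f U V; rewrite (curvature_lin3 LC) metric_linear.
- by move=> X' Y' Z' f U V; rewrite metricDr metricZr.
- move=> V X' Y' Z' W; rewrite (nabla_metric LC).
  by rewrite (sub3_eq0 (curvature_parallel V X' Y' Z')) metric_add3l.
- move=> X' Y' Z' W; apply: (mulfI a0); rewrite mulr0.
  have := congr1 (fun V => g V W p0) (curvature_killed W0 X' Y' Z').
  by rewrite metricZl metric0l CinfM.
Qed.

End Recurrent.
End Contact.

(** * Constant curvature and recurrence *)

Section ConstantCurvature.
Context {R : realType} {M : manifold R 3}.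
Local Notation C := (Cinf M).
Variables (S : contact_metric M) (nabla : vector_field M -> vector_field M -> vector_field M).
Hypothesis LC : levi_civita (cm_g S) nabla.
Local Notation g := (cm_g S).

(** The curvature is then a constant times a tensor built from [g], and [g] is parallel. *)
Lemma constant_curvature_parallel lambda : constant_curvature nabla g lambda ->
  forall W X Y Z, nabla_curvature nabla W X Y Z = 0.
Proof.
move=> cc W X Y Z; rewrite /nabla_curvature !cc.
have Wc : W (constf M lambda) = 0 by rewrite vfZ vf1 scaler0.
rewrite !(nabla_leibniz LC, nablaDr LC, nablaNr LC) Wc !(nabla_metric LC).
rewrite scale0r add0r !scalerDl -!scalerBr.
(* With the six fields abstracted, the product rule terms visibly cancel against the three
   correction terms. *)
move: (g (nabla W Y) Z *: X) (g Y (nabla W Z) *: X) (g Y Z *: nabla W X) => x1 x2 x3.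
move: (g (nabla W X) Z *: Y) (g X (nabla W Z) *: Y) (g X Z *: nabla W Y) => y1 y2 y3.
suff -> : x1 + x2 + x3 - (y1 + y2 + y3) - (x3 - y1) - (x1 - y3) - (x2 - y2) = 0.
  by rewrite scaler0.
by apply: vf_ext => f p; rewrite !(vf_addE, vf_oppE) vf_zeroE; ring.
Qed.

Lemma constant_curvature_eq0 lambda : phi_recurrent S nabla ->
  constant_curvature nabla g lambda -> lambda = 0.
Proof.
move=> [A [W AW] rec] cc; apply: contrapT => /eqP l0; apply: AW; apply: Cinf_ext => p.
rewrite Cinf0; apply/eqP/negPn/negP => a0.
have R0 X Y Z V : g (curvature nabla X Y Z) V p = 0.
  have := congr1 (fun U => g U V p) (rec X Y Z W).
  rewrite (constant_curvature_parallel cc) !linear0 metric0l metricZl CinfM Cinf0 => /esym/eqP.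
  by rewrite mulf_eq0 (negPf a0) => /eqP.
(* The constant curvature formula with the last two arguments equal to [cm_xi S]; dividing by
   [lambda] shows that [g] has rank one at [p]. *)
have gE X V : g X V p = g X (cm_xi S) p * g (cm_xi S) V p.
  have := R0 X (cm_xi S) (cm_xi S) V.
  rewrite cc metricZl metricDl metricNl !metricZl metric_xi_xi mul1r CinfM CinfZ Cinf1 mulr1 CinfD CinfN CinfM.
  by move/eqP; rewrite mulf_eq0 (negPf l0) subr_eq0 => /eqP.
(* Rank one makes [g X (cm_phi S Y)] a multiple of [g (cm_xi S) (cm_phi S Y)], which is zero by
   [cm_d_eta_xi]; so the exterior derivative would vanish at [p]. *)
have [X [Y]] := ext_d_nonzero S p; apply/negP; rewrite negbK.
have := cm_d_eta_xi S Y; rewrite !cm_d_eta_g => E.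
by rewrite gE E Cinf0 mulr0.
Qed.

End ConstantCurvature.

Theorem theorem4p4 (R : realType) (M : manifold R 3) (S : contact_metric M)
    (nabla : vector_field M -> vector_field M -> vector_field M)
    (hnabla : levi_civita (cm_g S) nabla) (hrec : phi_recurrent S nabla)
    (lambda : R) :
  constant_curvature nabla (cm_g S) lambda <-> lambda = 0.
Proof.
split=> [|->]; first exact: constant_curvature_eq0.
(* The recurrence alone already makes the curvature zero, so both sides of the identity with
   [lambda = 0] vanish. *)
have [A AX rec] := hrec => X Y Z.
by rewrite (curvature_flat hnabla rec AX) /constf !scale0r.
Qed.
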